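(* Let $p,q,r\ge 1$ be integers with $\frac1p+\frac1q+\frac1r>1$, and let $T_{p,q,r}$ be the quiver (without frozen nodes) described in the context, whose number of nodes is $n+1=p+q+r-1$. Let $\Gamma=\langle\gamma\rangle$, where $\gamma=\{A_1,(A_1A_2)\}$, act on the field $\mathbb{R}(\mathcal X_{T_{p,q,r}})$ of rational functions in the variables $x_1,x_2,y_2,\dots,y_p,z_2,\dots,z_q,w_2,\dots,w_r$ and on the field $\mathbb{R}(\mathcal A_{T_{p,q,r}})$ of rational functions in the variables $a_1,a_2,b_2,\dots,b_p,c_2,\dots,c_q,d_2,\dots,d_r$ as described in the context. Then on each of the $\mathcal X$ and $\mathcal A$ spaces there are exactly $n$ algebraically independent $\Gamma$-invariant functions, i.e. each of the fields $\mathbb{R}(\mathcal X_{T_{p,q,r}})^\Gamma$ and $\mathbb{R}(\mathcal A_{T_{p,q,r}})^\Gamma$ has transcendence degree exactly $n$ over $\mathbb{R}$. Explicitly: (1) The field $\mathbb{R}(\mathcal X_{T_{p,q,r}})^\Gamma$ is generated over $\mathbb{R}$ by the functions $$G(x_1,x_2)=\frac{(x_2(x_1+1)+1)^2}{x_1x_2},\quad y_2\,(x_2(x_1+1)+1),\quad z_2\,(x_2(x_1+1)+1),\quad w_2\,(x_2(x_1+1)+1),$$ together with the remaining $\mathcal X$ coordinates corresponding to nodes that are not connected to $A_1$ or $A_2$, namely $y_3,\dots,y_p,z_3,\dots,z_q,w_3,\dots,w_r$. (2) The field $\mathbb{R}(\mathcal A_{T_{p,q,r}})^\Gamma$ is generated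 over $\mathbb{R}$ by $\rho^*\big(\sqrt{G(x_1,x_2)}\big)$ together with the $n-1$ $\mathcal A$ coordinates associated to the nodes other than $A_1$ and $A_2$, namely $b_2,\dots,b_p,c_2,\dots,c_q,d_2,\dots,d_r$. (Functions involving variables that do not exist, because $p$, $q$ or $r$ is too small, are omitted from the lists.)
   Context: **The quiver $T_{p,q,r}$.** Its nodes are $A_1,A_2,B_2,\dots,B_p,C_2,\dots,C_q,D_2,\dots,D_r$. Its arrows are: a double arrow $A_1\Rightarrow A_2$; arrows $A_2\to B_2\to A_1$ (if $p\ge2$), $A_2\to C_2\to A_1$ (if $q\ge2$), $A_2\to D_2\to A_1$ (if $r\ge2$); and tails $B_{i+1}\to B_i$ for $2\le i<p$, $C_{i+1}\to C_i$ for $2\le i<q$, $D_{i+1}\to D_i$ for $2\le i<r$. The mutation classes of these quivers with $\frac1p+\frac1q+\frac1r>1$ are exactly the affine $ADE$ types: $(p,q,1)$ is type $\widetilde A_{p,q}$, $(n-2,2,2)$ is type $\widetilde D_n$, and $(n-3,3,2)$ is type $\widetilde E_n$, $n=6,7,8$. ''Trivial coefficients'' means there are no frozen nodes, and the rank is the number of nodes, $n+1$. The cluster ensemble is the pair $(\mathcal A,\mathcal X)$ of spaces generated from this initial seed, and rational functions on each space are identified with rational functions in the initial coordinates. **Coordinates.** The $\mathcal A$ coordinates attached to $A_1,A_2,B_i,C_i,D_i$ are $a_1,a_2,b_i,c_i,d_i$; the $\mathcal X$ coordinates are $x_1,x_2,y_i,z_i,w_i$ respectively. Let $\epsilon_{ij}$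 be the number of arrows from node $i$ to node $j$ (negative if the arrows go from $j$ to $i$). **Mutations.** Mutation at node $i$ replaces the $\mathcal A$ coordinate $a_i$ at $i$ by $a_i'=a_i^{-1}\big(\prod_{\epsilon_{ij}<0}a_j^{-\epsilon_{ij}}+\prod_{\epsilon_{ij}>0}a_j^{\epsilon_{ij}}\big)$ and leaves the other $\mathcal A$ coordinates unchanged. On $\mathcal X$ coordinates it gives $x_i'=x_i^{-1}$, $x_j'=x_j(1+x_i^{-\mathrm{sgn}(\epsilon_{ji})})^{-\epsilon_{ji}}$ if $\epsilon_{ji}\ne0$, and $x_j'=x_j$ for other $j\neq i$. **The group $\Gamma$.** The element $\gamma=\{A_1,(A_1A_2)\}$ consists of mutation at $A_1$ followed by the quiver isomorphism $T_{p,q,r}\to\mu_{A_1}(T_{p,q,r})$ swapping $A_1$ and $A_2$ and fixing the other nodes. It acts on a rational function by substituting, for the variable at each node $v$, the mutated variable at the image node $\sigma(v)$, where $\sigma=(A_1A_2)$. Explicitly, on $\mathcal A$: $a_1\mapsto a_2$, $a_2\mapsto (a_2^2+b_2c_2d_2)/a_1$ (nonexistent variables are replaced by $1$), all other variables fixed. On $\mathcal X$: $x_1\mapsto x_2(1+x_1)^2$, $x_2\mapsto x_1^{-1}$, $y_2\mapsto y_2x_1/(1+x_1)$, $z_2\mapsto z_2x_1/(1+x_1)$, $w_2\mapsto w_2x_1/(1+x_1)$, all other variables fixed. In types $\widetilde A_{p,q}$ and $\widetilde D_n$ (which come from an annulus with $p$ and $q$ marked points on its boundary components, respectively a twice-punctured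 disk with $n-2$ boundary marked points) the puncture preserving mapping class group of the surface is identified with $\Gamma=\langle\gamma\rangle\cong\mathbb Z$; in the $\widetilde E$ types $\Gamma=\langle\gamma\rangle$ is taken as its analog by definition. For a field with $\Gamma$-action, the superscript $\Gamma$ denotes the subfield of invariant elements. **The map $\rho$.** $\rho:\mathcal A\to\mathcal X$ is given by pullback: the $\mathcal X$ coordinate at node $i$ maps to $\prod_j a_j^{\epsilon_{ij}}$, where $a_j$ denotes the $\mathcal A$ coordinate at node $j$. Here $\rho^*(\sqrt{G})$ is the positive square root of $\rho^*(G)$, which is the rational function $\dfrac{a_1^2+a_2^2+b_2c_2d_2}{a_1a_2}$ (nonexistent variables replaced by $1$). *)

(* Defs.v *)
From HB Require Import structures.
From mathcomp Require Import all_boot all_order all_algebra.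
From mathcomp Require Import fraction mpoly reals ring lra zify.

Set Implicit Arguments.
Unset Strict Implicit.
Unset Printing Implicit Defensive.

Import Order.TTheory GRing.Theory Num.Theory.
Local Open Scope ring_scope.

Section FieldExtension.
Variables (k L : fieldType) (iota : {rmorphism k -> L}).

Inductive gen_field (S : L -> Prop) : L -> Prop :=
| gen_const c : gen_field S (iota c)
| gen_mem f : S f -> gen_field S f
| gen_add f g : gen_field S f -> gen_field S g -> gen_field S (f + g)
| gen_opp f : gen_field S f -> gen_field S (- f)
| gen_mul f g : gen_field S f -> gen_field S g -> gen_field S (f * g)
| gen_inv f : gen_field S f -> gen_field S f^-1.

Definition alg_indep (m : nat) (t : 'I_m -> L) : Prop :=
  forall P : {mpoly k[m]}, mmap iota t P = 0 -> P = 0.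

(* The largest number of algebraically independent elements of [F]. *)
Definition trdeg (F : L -> Prop) (m : nat) : Prop :=
  (exists2 t : 'I_m -> L, (forall i, F (t i)) & alg_indep t) /\
  (forall (m' : nat) (t : 'I_m' -> L),
     (forall i, F (t i)) -> alg_indep t -> (m' <= m)%N).

End FieldExtension.

(* The group of bijections generated by [g]. *)
Inductive gen_group (T : Type) (g : T -> T) : (T -> T) -> Prop :=
| gen_group_gen : gen_group g g
| gen_group_id : gen_group g id
| gen_group_comp f h : gen_group g f -> gen_group g h -> gen_group g (f \o h)
| gen_group_inv f h :
    gen_group g f -> cancel f h -> cancel h f -> gen_group g h.

Definition fixed_by (T : Type) (H : (T -> T) -> Prop) (x : T) : Prop :=
  forall h, H h -> h x = x.

Section LocalEvaluation.
Variables (M : nzRingType) (L : fieldType) (t s : {rmorphism M -> L}).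

(* [y] is the value at [s] of a fraction which is [f] at [t]. *)
Definition local_eval (f y : L) : Prop := exists P Q : M,
  [/\ t Q != 0, s Q != 0, f = t P / t Q & y = s P / s Q].

Lemma local_eval_id P : local_eval (t P) (s P).
Proof. by exists P, 1; rewrite !rmorph1 !divr1 oner_neq0; split. Qed.

Lemma local_eval1 : local_eval 1 1.
Proof. by rewrite -{1}(rmorph1 t) -(rmorph1 s); exact: local_eval_id. Qed.

Lemma local_evalD f y f' y' :
  local_eval f y -> local_eval f' y' -> local_eval (f + f') (y + y').
Proof.
move=> [P [Q [tQ sQ -> ->]]] [P' [Q' [tQ' sQ' -> ->]]].
exists (P * Q' + P' * Q), (Q * Q').
by rewrite !rmorphD !rmorphM !mulf_neq0 // !addf_div.
Qed.

Lemma local_evalM f y f' y' :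
  local_eval f y -> local_eval f' y' -> local_eval (f * f') (y * y').
Proof.
move=> [P [Q [tQ sQ -> ->]]] [P' [Q' [tQ' sQ' -> ->]]].
by exists (P * P'), (Q * Q'); rewrite !rmorphM !mulf_neq0 // !mulf_div.
Qed.

Lemma local_evalV f y : y != 0 -> f != 0 ->
  local_eval f y -> local_eval f^-1 y^-1.
Proof.
move=> y0 f0 [P [Q [tQ sQ fE yE]]]; exists Q, P; split.
- by apply: contraNneq f0 => P0; rewrite fE P0 mul0r.
- by apply: contraNneq y0 => P0; rewrite yE P0 mul0r.
- by rewrite fE invf_div.
- by rewrite yE invf_div.
Qed.

Lemma local_evalX f y k : local_eval f y -> local_eval (f ^+ k) (y ^+ k).
Proof.
move=> fy; elim: k => [|k IH]; rewrite ?expr0 ?exprS; first exact: local_eval1.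
exact: local_evalM.
Qed.

Lemma local_eval0 y : (forall P, t P = 0 -> s P = 0) ->
  local_eval 0 y -> y = 0.
Proof.
move=> ts [P [Q [tQ sQ /esym/eqP + ->]]].
rewrite mulf_eq0 invr_eq0 (negPf tQ) orbF => /eqP /ts ->.
exact: mul0r.
Qed.

End LocalEvaluation.

Section RationalFunctions.
Variables (R : realType) (N : finType).

Definition ratfun : fieldType := {fraction {mpoly R[#|N|]}}.
Local Notation K := ratfun.

Definition polyfrac : {rmorphism {mpoly R[#|N|]} -> K} :=
  @tofrac {mpoly R[#|N|]}.

Lemma polyfrac_eq P Q : (polyfrac P == polyfrac Q) = (P == Q).
Proof. exact: tofrac_eq. Qed.

Lemma polyfrac_eq0 P : (polyfrac P == 0) = (P == 0).
Proof. exact: tofrac_eq0. Qed.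

Definition ratC : {rmorphism R -> K} := polyfrac \o @mpolyC #|N| R.

Definition var (v : N) : K := polyfrac 'X_(enum_rank v).

Definition psubst (g : N -> K) : {rmorphism {mpoly R[#|N|]} -> K} :=
  mmap ratC (g \o enum_val).

(* Substitution of [g v] for the variable at [v], computed on some fraction
   representing [f].  When the [g v] are algebraically independent, i.e., when
   [psubst g] is injective, the choice of that fraction is immaterial and no
   denominator vanishes: see [subst_frac].  This covers the two substitutions
   used below, by [psubst_gammaA_inj] and [psubst_gammaX_inj]. *)
Definition subst (g : N -> K) (f : K) : K :=
  psubst g (\n_(repr f)) / psubst g (\d_(repr f)).

Lemma ratfunE (f : K) : f = polyfrac \n_(repr f) / polyfrac \d_(repr f).
Proof.
have d0 : \d_(repr f) != 0 := denom_ratioP _.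
apply: (canRL (mulfK _)); first by rewrite polyfrac_eq0.
rewrite -{1}[f]reprK; move: d0; set x := repr f => d0; rewrite /polyfrac.
unlock tofrac; rewrite !piE; apply/eqP; rewrite piE /= FracField.equivfE.
by rewrite /FracField.mulf !numden_Ratio ?mulf_neq0 ?oner_neq0 // !mulr1 mulrC.
Qed.

Lemma psubstE g P : psubst g P = mmap ratC (g \o enum_val) P.
Proof. by []. Qed.

Lemma psubstX g v : psubst g 'X_(enum_rank v) = g v.
Proof. by rewrite psubstE mmapX mmap1U /= enum_rankK. Qed.

Lemma psubstC g c : psubst g c%:MP = ratC c.
Proof. exact: mmapC. Qed.

Lemma psubst_var P : psubst var P = polyfrac P.
Proof.
elim/mpolyind: P => [|c m P _ _ IH]; first by rewrite !rmorph0.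
rewrite !rmorphD /= IH; congr (_ + _).
rewrite -mul_mpolyC !rmorphM /= psubstC; congr (_ * _).
rewrite [in RHS]mpolyXE_id psubstE mmapX /mmap1 rmorph_prod.
by apply: eq_bigr => i _; rewrite rmorphXn /= /var enum_valK.
Qed.

Lemma subst_frac g P Q : injective (psubst g) -> Q != 0 ->
  subst g (polyfrac P / polyfrac Q) = psubst g P / psubst g Q.
Proof.
move=> g_inj Q0; set f := polyfrac P / polyfrac Q.
have sneq0 S : S != 0 -> psubst g S != 0.
  by apply: contra_neq => S0; apply: g_inj; rewrite S0 rmorph0.
have d0 : \d_(repr f) != 0 := denom_ratioP _.
have /eqP := ratfunE f.
rewrite {1}/f eqr_div ?polyfrac_eq0 // -!rmorphM /= polyfrac_eq => /eqP eqPQ.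
apply/eqP; rewrite /subst eqr_div ?sneq0 // -!rmorphM /=.
by rewrite eqPQ mulrC.
Qed.

Lemma psubst_inj (g h : N -> K) :
  (forall v, local_eval polyfrac (psubst h) (g v) (var v)) ->
  injective (psubst g).
Proof.
move=> gh.
have reg_subst P :
    local_eval polyfrac (psubst h) (psubst g P) (polyfrac P).
  rewrite -psubst_var; elim/mpolyind: P => [|c m P _ _ IH].
    by rewrite !rmorph0 -(rmorph0 polyfrac)
      -[X in local_eval _ _ _ X](rmorph0 (psubst h)); exact: local_eval_id.
  rewrite !rmorphD /=; apply: local_evalD => //.
  rewrite -mul_mpolyC !rmorphM /= !psubstC; apply: local_evalM => //.
    by rewrite -[X in local_eval _ _ _ X](psubstC h); exact: local_eval_id.
  rewrite !psubstE !mmapX /mmap1.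
  apply: (big_ind2 (local_eval _ (psubst h))).
  - rewrite -[X in local_eval _ _ _ X](rmorph1 (psubst h)).
    by rewrite -(rmorph1 polyfrac); exact: local_eval_id.
  - by move=> *; exact: local_evalM.
  - by move=> i _; apply: local_evalX; exact: gh.
suff ker0 P : psubst g P = 0 -> P = 0.
  move=> P P' /eqP; rewrite -subr_eq0 -rmorphB => /eqP /ker0 /eqP.
  by rewrite subr_eq0 => /eqP.
move=> P0; have := reg_subst P; rewrite P0 => H.
apply/eqP; rewrite -polyfrac_eq0; apply/eqP; apply: (local_eval0 _ H) => S /eqP.
by rewrite polyfrac_eq0 => /eqP ->; exact: rmorph0.
Qed.

Lemma local_eval_var h v :
  local_eval polyfrac (psubst h) (var v) (h v).
Proof. by rewrite -[X in local_eval _ _ _ X](psubstX h); exact: local_eval_id. Qed.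

Lemma var_neq0 v : var v != 0.
Proof. by rewrite polyfrac_eq0 -msupp_eq0 msuppX. Qed.

Lemma local_eval_neq0 h f y :
  local_eval polyfrac (psubst h) f y -> y != 0 -> f != 0.
Proof.
move=> + /eqP y0; apply: contraPneq => -> H; apply: y0.
apply: (local_eval0 _ H) => S /eqP.
by rewrite polyfrac_eq0 => /eqP ->; exact: rmorph0.
Qed.

End RationalFunctions.
Arguments ratC {R N}.
Arguments var {R N}.

Section Mutation.
Variables (N : finType) (eps : N -> N -> int) (K : fieldType).

Definition mutA (k : N) (a : N -> K) (j : N) : K :=
  if j == k then
    (a k)^-1 * (\prod_(l | eps k l < 0) a l ^ (- eps k l)
                + \prod_(l | eps k l > 0) a l ^ eps k l)
  else a j.

Definition mutX (k : N) (x : N -> K) (j : N) : K :=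
  if j == k then (x k)^-1
  else if eps j k == 0 then x j
  else x j * (1 + x k ^ (- sgz (eps j k))) ^ (- eps j k).

Definition rho_pullback (a : N -> K) (i : N) : K := \prod_j a j ^ eps i j.

End Mutation.

(* [B i], [C i], [D i] stand for the nodes B_(i+2), C_(i+2), D_(i+2). *)
Inductive node (p q r : nat) : Type :=
| A1 | A2 | B of 'I_p.-1 | C of 'I_q.-1 | D of 'I_r.-1.
Arguments A1 {p q r}.
Arguments A2 {p q r}.
Arguments B {p q r}.
Arguments C {p q r}.
Arguments D {p q r}.

Section NodeFinType.
Variables p q r : nat.

Definition node_code (v : node p q r) :
    bool + ('I_p.-1 + ('I_q.-1 + 'I_r.-1)) :=
  match v with
  | A1 => inl true
  | A2 => inl false
  | B i => inr (inl i)
  | C i => inr (inr (inl i))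
  | D i => inr (inr (inr i))
  end.

Definition node_decode (s : bool + ('I_p.-1 + ('I_q.-1 + 'I_r.-1))) :
    node p q r :=
  match s with
  | inl true => A1
  | inl false => A2
  | inr (inl i) => B i
  | inr (inr (inl i)) => C i
  | inr (inr (inr i)) => D i
  end.

Lemma node_codeK : cancel node_code node_decode.
Proof. by case. Qed.

Lemma node_decodeK : cancel node_decode node_code.
Proof. by case=> [[]|[|[]]]. Qed.

HB.instance Definition _ := Equality.copy (node p q r) (can_type node_codeK).
HB.instance Definition _ := Choice.copy (node p q r) (can_type node_codeK).
HB.instance Definition _ := Countable.copy (node p q r) (can_type node_codeK).
HB.instance Definition _ : isFinite (node p q r) := CanIsFinite node_codeK.

Lemma card_node : (0 < p)%N -> (0 < q)%N -> (0 < r)%N ->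
  #|{: node p q r}| = (p + q + r - 1)%N.
Proof.
move=> p0 q0 r0.
rewrite (bij_eq_card (Bijective node_codeK node_decodeK)).
by rewrite !card_sum card_bool !card_ord; lia.
Qed.

Lemma big_node (T : Type) (idx : T) (op : Monoid.com_law idx)
    (P : pred (node p q r)) (F : node p q r -> T) :
  \big[op/idx]_(v | P v) F v =
  op (if P A1 then F A1 else idx) (op (if P A2 then F A2 else idx)
    (op (\big[op/idx]_(i | P (B i)) F (B i))
    (op (\big[op/idx]_(i | P (C i)) F (C i))
        (\big[op/idx]_(i | P (D i)) F (D i))))).
Proof.
rewrite (reindex node_decode) /=; last first.
  by apply: onW_bij; exact: Bijective node_decodeK node_codeK.
by rewrite 3!big_sumType /= big_mkcond big_bool /= !Monoid.mulmA.
Qed.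

End NodeFinType.

Section Tpqr.
Variables p q r : nat.
Local Notation node := (node p q r).

Definition arrows (u v : node) : nat :=
  match u, v with
  | A1, A2 => 2
  | A2, B i | A2, C i | A2, D i => (i == 0 :> nat)
  | B i, A1 | C i, A1 | D i, A1 => (i == 0 :> nat)
  | B i, B j | C i, C j | D i, D j => (i == j.+1 :> nat)
  | _, _ => 0
  end.

Definition eps (u v : node) : int := (arrows u v)%:Z - (arrows v u)%:Z.

Definition swapA (v : node) : node :=
  match v with A1 => A2 | A2 => A1 | _ => v end.

End Tpqr.

Section Invariants.
Variables (R : realType) (p q r : nat).
Local Notation node := (node p q r).
Local Notation K := (ratfun R node).
Implicit Types (f : K).

(* The mutated variable at the image of [v] by the quiver isomorphism [swapA];
   explicit formulas are [gammaA_imgE] and [gammaX_imgE] below. *)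
Definition gammaA_img (v : node) : K := mutA (@eps p q r) A1 var (swapA v).
Definition gammaX_img (v : node) : K := mutX (@eps p q r) A1 var (swapA v).

Definition gammaA : K -> K := subst gammaA_img.
Definition gammaX : K -> K := subst gammaX_img.

Definition A_invariant : K -> Prop := fixed_by (gen_group gammaA).
Definition X_invariant : K -> Prop := fixed_by (gen_group gammaX).

Definition G (x1 x2 : K) : K := (x2 * (x1 + 1) + 1) ^+ 2 / (x1 * x2).

Inductive X_generator : K -> Prop :=
| Xgen_G : X_generator (G (var A1) (var A2))
| Xgen_y2 (i : 'I_p.-1) : i = 0 :> nat ->
    X_generator (var (B i) * (var A2 * (var A1 + 1) + 1))
| Xgen_z2 (i : 'I_q.-1) : i = 0 :> nat ->
    X_generator (var (C i) * (var A2 * (var A1 + 1) + 1))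
| Xgen_w2 (i : 'I_r.-1) : i = 0 :> nat ->
    X_generator (var (D i) * (var A2 * (var A1 + 1) + 1))
| Xgen_y (i : 'I_p.-1) : i <> 0 :> nat -> X_generator (var (B i))
| Xgen_z (i : 'I_q.-1) : i <> 0 :> nat -> X_generator (var (C i))
| Xgen_w (i : 'I_r.-1) : i <> 0 :> nat -> X_generator (var (D i)).

(* b_2 c_2 d_2, each factor being 1 when the variable does not exist. *)
Definition b2c2d2 : K :=
  (\prod_(i < p.-1 | i == 0 :> nat) var (B i)) *
  (\prod_(i < q.-1 | i == 0 :> nat) var (C i)) *
  (\prod_(i < r.-1 | i == 0 :> nat) var (D i)).

(* The square root of the pullback of [G] by rho (see [rho_sqrtG_sqr]) that is
   positive at positive values of the variables (see [rho_sqrtG_pos]). *)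
Definition rho_sqrtG : K :=
  (var A1 ^+ 2 + var A2 ^+ 2 + b2c2d2) / (var A1 * var A2).

Inductive A_generator : K -> Prop :=
| Agen_sqrtG : A_generator rho_sqrtG
| Agen_b (i : 'I_p.-1) : A_generator (var (B i))
| Agen_c (i : 'I_q.-1) : A_generator (var (C i))
| Agen_d (i : 'I_r.-1) : A_generator (var (D i)).

Local Notation tf := (@polyfrac R node).

Lemma gammaA_imgE v : gammaA_img v =
  match v with
  | A1 => var A2
  | A2 => (var A2 ^+ 2 + b2c2d2) / var A1
  | _ => var v
  end.
Proof.
rewrite /gammaA_img /mutA; case: v => [||i|i|i] //=.
rewrite mulrC; congr (_ / _); rewrite addrC; congr (_ + _).
  rewrite big_node /= !big1 ?mulr1 ?mul1r //=; first last.
  - by move=> i; rewrite /eps /=; case: eqP.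
  - by move=> i; rewrite /eps /=; case: eqP.
  - by move=> i; rewrite /eps /=; case: eqP.
rewrite big_node /= !mul1r /b2c2d2 -mulrA.
by congr (_ * (_ * _)); apply: eq_big => i; rewrite /eps /=; case: eqP.
Qed.

Lemma gammaX_imgE v : gammaX_img v =
  match v with
  | A1 => var A2 * (1 + var A1) ^+ 2
  | A2 => (var A1)^-1
  | B i => if i == 0 :> nat then var v * var A1 / (1 + var A1) else var v
  | C i => if i == 0 :> nat then var v * var A1 / (1 + var A1) else var v
  | D i => if i == 0 :> nat then var v * var A1 / (1 + var A1) else var v
  end.
Proof.
have x0 := @var_neq0 R node A1.
have arm (x y : K) : x != 0 -> y * (1 + x ^ (- sgz (1 : int))) ^ (- 1) = y * x / (1 + x).
  move=> xN0; rewrite -mulrA; congr (_ * _).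
  rewrite -invf_div; congr (_^-1).
  by rewrite mulrDl mul1r mulfV // addrC.
rewrite /gammaX_img /mutX; case: v => [||i|i|i] //=.
- by rewrite /eps /=; case: (_ == 0%N) => //=; exact: arm.
- by rewrite /eps /=; case: (_ == 0%N) => //=; exact: arm.
- by rewrite /eps /=; case: (_ == 0%N) => //=; exact: arm.
Qed.

Lemma b2c2d2_pos (c : node -> R) : (forall v, 0 < c v) -> exists2 y,
  0 < y & local_eval tf (psubst (fun v => ratC (c v))) b2c2d2 (ratC y).
Proof.
move=> c_gt0; pose h v : K := ratC (c v).
have prod_pos m (u : 'I_m -> node) : exists2 y, 0 < y &
    local_eval tf (psubst h) (\prod_(i < m | i == 0 :> nat) var (u i)) (ratC y).
  apply: (big_rec (fun x => exists2 y, 0 < y &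
    local_eval tf (psubst h) x (ratC y))) => [|i x _ [y y_gt0 hy]].
    by exists 1 => //; rewrite rmorph1; exact: local_eval1.
  exists (c (u i) * y); first exact: mulr_gt0.
  by rewrite rmorphM; apply: local_evalM => //; exact: (local_eval_var h).
have [y1 ? h1] := prod_pos _ B.
have [y2 ? h2] := prod_pos _ C.
have [y3 ? h3] := prod_pos _ D.
exists (y1 * y2 * y3); first by rewrite !mulr_gt0.
by rewrite !rmorphM; do 2!apply: local_evalM => //.
Qed.

Lemma b2c2d2_neq0 : b2c2d2 != 0.
Proof.
have [y y_gt0 /local_eval_neq0] := b2c2d2_pos (c := fun=> 1) (fun=> ltr01).
by apply; rewrite polyfrac_eq0 mpolyC_eq0 gt_eqF.
Qed.

Lemma rho_sqrtG_pos (c : node -> R) : (forall v, 0 < c v) -> exists2 y,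
  0 < y & local_eval tf (psubst (fun v => ratC (c v))) rho_sqrtG (ratC y).
Proof.
move=> c_gt0; have [y y_gt0 hy] := b2c2d2_pos c_gt0.
pose h v : K := ratC (c v); have hv := local_eval_var h.
have C0 v : h v != 0 by rewrite polyfrac_eq0 mpolyC_eq0 gt_eqF.
exists ((c A1 ^+ 2 + c A2 ^+ 2 + y) / (c A1 * c A2)).
  by rewrite divr_gt0 ?addr_gt0 ?exprn_gt0 ?mulr_gt0.
rewrite fmorph_div !rmorphD !rmorphXn rmorphM; apply: local_evalM.
  by apply: local_evalD => //; apply: local_evalD; apply: local_evalX; exact: hv.
apply: local_evalV.
- exact: mulf_neq0 (C0 A1) (C0 A2).
- by rewrite mulf_neq0 ?var_neq0.
- exact: local_evalM (hv A1) (hv A2).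
Qed.

Lemma rho_sqrtG_sqr :
  rho_sqrtG ^+ 2 = G (rho_pullback (@eps p q r) var A1)
                     (rho_pullback (@eps p q r) var A2).
Proof.
have arm m (u : 'I_m -> node) (e : int) :
    \prod_(i < m) var (u i) ^ ((i == 0 :> nat)%:Z * e)
    = (\prod_(i < m | i == 0 :> nat) var (u i)) ^ e :> K.
  rewrite (big_morph (fun x : K => x ^ e) (fun x y => expfzMl x y e) (exp1rz K e)).
  rewrite [RHS]big_mkcond; apply: eq_bigr => i _.
  by case: (_ == 0%N); rewrite ?mul1r ?mul0r ?expr0z.
have rho1 : rho_pullback (@eps p q r) var A1 = var A2 ^+ 2 / b2c2d2 :> K.
  rewrite /rho_pullback big_node /= expr0z mul1r; congr (_ * _).
  rewrite /b2c2d2 -exprN1 !expfzMl -mulrA -!arm.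
  by congr (_ * (_ * _)); apply: eq_bigr => i _; rewrite mulrN1 /eps sub0r.
have rho2 : rho_pullback (@eps p q r) var A2 = b2c2d2 / var A1 ^+ 2 :> K.
  rewrite /rho_pullback big_node /= expr0z mul1r mulrC; congr (_ * _).
  rewrite /b2c2d2 -[RHS]expr1z !expfzMl -mulrA -!arm.
  by congr (_ * (_ * _)); apply: eq_bigr => i _; rewrite mulr1 /eps subr0.
have alg (F : fieldType) (a1 a2 m : F) : a1 != 0 -> a2 != 0 -> m != 0 ->
    ((a1 ^+ 2 + a2 ^+ 2 + m) / (a1 * a2)) ^+ 2 =
    (m / a1 ^+ 2 * (a2 ^+ 2 / m + 1) + 1) ^+ 2
      / (a2 ^+ 2 / m * (m / a1 ^+ 2)).
  by move=> a10 a20 m0; field; rewrite a10 a20 m0.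
rewrite rho1 rho2 /rho_sqrtG /G.
exact: (alg K _ _ _ (var_neq0 R A1) (var_neq0 R A2) b2c2d2_neq0).
Qed.

Lemma psubst_gammaA_inj : injective (psubst gammaA_img).
Proof.
have den0 : var A1 ^+ 2 + b2c2d2 != 0 :> K.
  have [y y_gt0 ymE] := b2c2d2_pos (c := fun=> 1) (fun=> ltr01).
  apply: (local_eval_neq0 (h := fun=> ratC 1) (y := ratC 1 ^+ 2 + ratC y)).
    by apply: local_evalD => //; apply: local_evalX; exact: local_eval_var.
  rewrite -rmorphXn -rmorphD /= polyfrac_eq0 mpolyC_eq0 expr1n.
  by rewrite gt_eqF // addr_gt0.
pose h (v : node) : K := match v with
  | A1 => (var A1 ^+ 2 + b2c2d2) / var A2 | A2 => var A1 | _ => var v end.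
have hm : local_eval tf (psubst h) b2c2d2 b2c2d2.
  have hprod m (u : 'I_m -> node) : (forall i, h (u i) = var (u i)) ->
      local_eval tf (psubst h) (\prod_(i < m | i == 0 :> nat) var (u i))
                               (\prod_(i < m | i == 0 :> nat) var (u i)).
    move=> hu; apply: (big_ind2 (local_eval tf (psubst h))).
    - exact: local_eval1.
    - by move=> x y z t; exact: local_evalM.
    - by move=> i _; rewrite -[X in local_eval _ _ _ X]hu; exact: local_eval_var.
  apply: local_evalM; first apply: local_evalM.
  - exact: hprod.
  - exact: hprod.
  - exact: hprod.
apply: (psubst_inj (h := h)) => v; rewrite gammaA_imgE.
case: v => [||i|i|i]; try exact: (local_eval_var h).
have A2E : var A2 = (var A1 ^+ 2 + b2c2d2) / h A1 :> K.
  by rewrite /= invf_div mulrC divfK.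
rewrite [X in local_eval _ _ _ X]A2E.
apply: local_evalM.
  by apply: local_evalD => //; apply: local_evalX; exact: (local_eval_var h).
apply: local_evalV; last exact: (local_eval_var h).
  by apply: (mulf_neq0 den0); rewrite invr_eq0; exact: var_neq0.
exact: var_neq0.
Qed.

Lemma psubst_gammaX_inj : injective (psubst gammaX_img).
Proof.
pose y1 : K := var A1; pose y2 : K := var A2.
have y10 : y1 != 0 := var_neq0 _ _.
have y20 : y2 != 0 := var_neq0 _ _.
have S0 (v : node) : 1 + var v != 0 :> K.
  apply: (local_eval_neq0 (h := fun=> 1) (y := 1 + 1)).
    by apply: local_evalD; [exact: local_eval1|exact: local_eval_var].
  rewrite -(rmorph1 (@ratC R node)) -rmorphD /= polyfrac_eq0 mpolyC_eq0.
  by rewrite -mulr2n pnatr_eq0.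
pose h (v : node) : K := match v with
  | A1 => y2^-1
  | A2 => y1 * y2 ^+ 2 / (1 + y2) ^+ 2
  | B i => if i == 0 :> nat then var v * (1 + y2) else var v
  | C i => if i == 0 :> nat then var v * (1 + y2) else var v
  | D i => if i == 0 :> nat then var v * (1 + y2) else var v
  end.
have hv := local_eval_var h.
have S1 : local_eval tf (psubst h) (1 + y1) (1 + y2^-1).
  by apply: local_evalD; [exact: local_eval1|exact: (hv A1)].
have S1E : 1 + y2^-1 = (1 + y2) / y2.
  by rewrite mulrDl mul1r (mulfV y20) addrC.
have V20 : y2^-1 != 0 by rewrite invr_eq0; exact: y20.
have S1_neq0 : 1 + y2^-1 != 0 by rewrite S1E; exact: mulf_neq0 (S0 A2) V20.
have S1V : local_eval tf (psubst h) (1 + y1)^-1 (1 + y2^-1)^-1.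
  apply: local_evalV (S1); last exact: S0.
  exact: S1_neq0.
have arm (u v : K) : local_eval tf (psubst h) u (v * (1 + y2)) ->
    local_eval tf (psubst h) (u * var A1 / (1 + var A1)) v.
  move=> uv; have -> : v = v * (1 + y2) * y2^-1 / (1 + y2^-1).
    by rewrite -(mulrA v) -S1E (mulfK S1_neq0).
  by apply: local_evalM => //; apply: local_evalM => //; exact: (hv A1).
apply: (psubst_inj (h := h)) => v; rewrite gammaX_imgE.
case: v => [||i|i|i].
- have A1E : var A1 = h A2 * (1 + y2^-1) ^+ 2.
    rewrite S1E expr_div_n mulrA (divfK (expf_neq0 2 (S0 A2))).
    by rewrite (mulfK (expf_neq0 2 y20)).
  rewrite [X in local_eval _ _ _ X]A1E.
  by apply: local_evalM; [exact: hv|exact: local_evalX].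
- rewrite -[X in local_eval _ _ _ X]invrK.
  by apply: local_evalV; [exact: V20|exact: y10|exact: (hv A1)].
- by have := hv (B i); rewrite /h; case: (_ == 0%N) => //; exact: arm.
- by have := hv (C i); rewrite /h; case: (_ == 0%N) => //; exact: arm.
- by have := hv (D i); rewrite /h; case: (_ == 0%N) => //; exact: arm.
Qed.

End Invariants.
Arguments A_invariant : clear implicits.
Arguments X_invariant : clear implicits.
Arguments A_generator : clear implicits.
Arguments X_generator : clear implicits.

(* Main.v *)
Require Import Defs.
From HB Require Import structures.
From mathcomp Require Import all_boot all_order all_algebra.
From mathcomp Require Import fraction mpoly reals ring lra zify.

Set Implicit Arguments.
Unset Strict Implicit.
Unset Printing Implicit Defensive.

Import Order.TTheory GRing.Theory Num.Theory.
Local Open Scope ring_scope.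

(** Both spaces carry the same dynamical system.  On the A side put x = a_2,
z = a_1, c = 0 and m = b_2 c_2 d_2; on the X side put x = x_1, z = 1/x_2,
c = 2 and m = 1.  In either case the generator gamma sends
  z to x   and   x to (x^2 + c x + m) / z,
and it preserves T = (x^2 + z^2 + c (x + z) + m) / (x z).  This T is the
square root of the pullback of G on the A side and G - 2 on the X side.  The
other proposed generators are fixed by gamma, and together with x and z they
generate the whole function field K.

Let F be the field generated by the proposed invariants.  The definition of T
says that z is a root of a quadratic polynomial over F(x), whose discriminant
is a quadratic polynomial in x that is not a square, because its own
discriminant 16 (T + 2) (c^2 + m (T - 2)) is nonzero.  Moreover the orbit of x
is infinite: at the point where all the variables are 1 it takes strictly
increasing positive real values.  Now let f be fixed by gamma and write
f = (P(x) + Q(x) z) / (U(x) + V(x) z) with coefficients in F.  Then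
A(x) + B(x) z = 0 for A = P - f U and B = Q - f V, so the norm of A + B z is a
polynomial in x with invariant coefficients which vanishes at x, hence on its
whole orbit, hence identically.  As the discriminant is not a square, this
forces A = B = 0, and f is a quotient of coefficients, which lies in F
([fixed_gen_field], [recurrence_fixed_field]).

For the transcendence degree, the infinite orbit also shows that x is
transcendental over the invariants.  So m independent invariants give m + 1
independent elements of K, and K has at most as many as it has variables, by
counting the monomials of bounded degree ([monomials_lindep],
[card_fixed_alg_indep]).  Conversely the n proposed generators are
independent: at a_1 = a_2 = 0, respectively x_1 = x_2 = 0, the first one has a
pole while the others specialise to distinct variables
([alg_indep_pole], [trdeg_invariants]). *)

(** * Algebraic dependence by counting monomials *)

Section Counting.
Variable F : fieldType.

Lemma card_bmultinom_le d b : (#|{: 'X_{1..d < b}}| <= b ^ d)%N.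
Proof.
have lt_mb (m : 'X_{1..d < b}) i : (m i < b)%N.
  by apply: leq_ltn_trans (bmdeg m); rewrite mdegE (bigD1 i) //= leq_addr.
pose e (m : 'X_{1..d < b}) := [ffun i : 'I_d => Ordinal (lt_mb m i)].
have e_inj : injective e.
  move=> m m' /ffunP mm'; apply/val_inj/mnmP => i.
  by have := congr1 val (mm' i); rewrite !ffunE.
by have := leq_card e e_inj; rewrite card_ffun !card_ord.
Qed.

(** The coefficient matrix of the family has more rows than columns. *)
Lemma mpoly_lindep (A : finType) d b (W : A -> {mpoly F[d]}) :
    (forall a, msize (W a) <= b)%N -> (b ^ d < #|A|)%N ->
  exists2 c : A -> F, (exists a, c a != 0) & \sum_a c a *: W a = 0.
Proof.
move=> Wb bA.
pose M := \matrix_(i < #|A|, j < #|{: 'X_{1..d < b}}|)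
            (W (enum_val i))@_(enum_val j : 'X_{1..d < b}).
have : kermx M != 0.
  rewrite kermx_eq0 /row_free neq_ltn (leq_ltn_trans (rank_leq_col M)) //.
  exact: leq_ltn_trans (card_bmultinom_le d b) bA.
case/rowV0Pn => v /sub_kermxP vM v0.
exists (fun a => v 0 (enum_rank a)).
  apply/existsP; apply: contraNT v0 => /existsPn v0; apply/eqP/rowP => i.
  by have /negPn/eqP := v0 (enum_val i); rewrite enum_valK mxE.
apply/mpolyP => m; rewrite raddf_sum mcoeff0 /=.
have [mb|mb] := ltnP (mdeg m) b; last first.
  rewrite big1 // => a _; rewrite mcoeffZ memN_msupp_eq0 ?mulr0 //.
  by apply: msize_mdeg_ge; exact: leq_trans (Wb a) mb.
have /rowP/(_ (enum_rank (BMultinom mb))) := vM; rewrite !mxE => vM0.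
rewrite -[RHS]vM0 (reindex _ (onW_bij _ (@enum_val_bij A))) /=.
by apply: eq_bigr => i _; rewrite mcoeffZ enum_valK mxE enum_rankK.
Qed.

Lemma msizeM_leS d (P Q : {mpoly F[d]}) a b :
  (msize P <= a.+1 -> msize Q <= b.+1 -> msize (P * Q) <= (a + b).+1)%N.
Proof.
have [->|P0] := eqVneq P 0; first by rewrite mul0r msize0.
have [->|Q0] := eqVneq Q 0; first by rewrite mulr0 msize0.
rewrite msizeM //; move: (msize P) (msize Q) => u v; lia.
Qed.

Lemma msizeX_leS d (P : {mpoly F[d]}) s e :
  (msize P <= s.+1 -> msize (P ^+ e) <= (s * e).+1)%N.
Proof.
move=> Ps; elim: e => [|e IH]; first by rewrite expr0 msize1.
by rewrite exprS mulnS; exact: msizeM_leS.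
Qed.

Lemma msize_prod_leS d k (P : 'I_k -> {mpoly F[d]}) s D :
  (forall i, msize (P i) <= (s * D).+1)%N ->
  (msize (\prod_i P i) <= (s * D * k).+1)%N.
Proof.
elim: k P => [|k IH] P Ps; first by rewrite big_ord0 msize1.
by rewrite big_ord_recl mulnS; apply: msizeM_leS => //; exact: IH.
Qed.

(** The exponents below [D] of [k] elements outnumber the monomials of degree
    at most [s * D * k] in [d] variables once [D] exceeds [(s * k + 1) ^ d]. *)
Lemma exp_growth d k s : (d < k)%N -> exists D, ((s * D * k).+1 ^ d < D ^ k)%N.
Proof.
move=> dk; pose C := (s * k).+1; exists (C ^ d).+1; set D := (C ^ d).+1.
apply: (@leq_ltn_trans ((C * D) ^ d)).
  by case: (d) => [|d1]; rewrite ?expn0 // leq_exp2r // /C; nia.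
apply: (@leq_trans (D ^ d.+1)); last exact: leq_pexp2l.
by rewrite expnMn expnSr mulnC ltn_pmul2l ?expn_gt0.
Qed.

Lemma clear_denominator (a b : F) e D : (e <= D)%N -> b != 0 ->
  (a / b) ^+ e * b ^+ D = a ^+ e * b ^+ (D - e).
Proof.
by move=> eD b0; rewrite -{1}(subnKC eD) exprD mulrA -exprMn divfK.
Qed.

End Counting.

Section CountingRatfun.
Variables (R : realType) (N : finType).
Local Notation K := (ratfun R N).
Local Notation tf := (@polyfrac R N).

Lemma common_denominator k (f : 'I_k -> K) :
  exists2 Q, Q != 0 & exists P, forall i, f i = tf (P i) / tf Q.
Proof.
pose n i := \n_(repr (f i)); pose d i := \d_(repr (f i)).
have d0 i : d i != 0 := denom_ratioP _.
exists (\prod_i d i); first exact/prodf_neq0.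
exists (fun i => n i * \prod_(j | j != i) d j) => i.
have -> : \prod_j d j = d i * \prod_(j | j != i) d j by exact: bigD1.
rewrite [LHS]ratfunE !rmorphM -mulf_div divff ?mulr1 //.
by rewrite polyfrac_eq0; apply/prodf_neq0.
Qed.

(** Multiplying by a power of a common denominator turns the monomials with
    exponents below [D] into polynomials whose degree grows linearly in [D],
    so for large [D] there are too many of them to be independent. *)
Lemma monomials_lindep k (f : 'I_k -> K) : (#|N| < k)%N ->
  exists D, exists2 c : {ffun 'I_k -> 'I_D} -> R, (exists e, c e != 0) &
    \sum_e ratC (c e) * \prod_i f i ^+ e i = 0.
Proof.
move=> Nk; have [Q Q0 [P fE]] := common_denominator f.
pose s := (\max_i msize (P i) + msize Q)%N.
have Ps i : (msize (P i) <= s.+1)%N.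
  by apply: leqW; apply: leq_trans (leq_addr _ _); exact: leq_bigmax.
have Qs : (msize Q <= s.+1)%N by apply: leqW; exact: leq_addl.
have [D Dk] := exp_growth s Nk; exists D.
(* Each factor has degree at most [s * D], whatever the exponent [e i]. *)
pose W (e : {ffun 'I_k -> 'I_D}) := \prod_i (P i ^+ e i * Q ^+ (D - e i)).
have Ws e : (msize (W e) <= (s * D * k).+1)%N.
  apply: msize_prod_leS => i.
  have -> : (s * D = s * e i + s * (D - e i))%N.
    by rewrite -mulnDr subnKC // ltnW.
  by apply: msizeM_leS; exact: msizeX_leS.
have cardA : ((s * D * k).+1 ^ #|N| < #|{ffun 'I_k -> 'I_D}|)%N.
  by rewrite card_ffun !card_ord.
have [c c0 cW] := mpoly_lindep Ws cardA; exists c => //.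
have tQ0 : tf Q != 0 by rewrite polyfrac_eq0.
apply: (mulIf (expf_neq0 (D * k) tQ0)); rewrite mul0r.
transitivity (tf (\sum_e c e *: W e)); last by rewrite cW rmorph0.
rewrite rmorph_sum mulr_suml; apply: eq_bigr => e _.
have -> : c e *: W e = (c e)%:MP * W e by rewrite mul_mpolyC.
rewrite rmorphM -mulrA; congr (_ * _).
have -> : tf Q ^+ (D * k) = \prod_(i < k) tf Q ^+ D.
  by rewrite prodr_const card_ord exprM.
rewrite rmorph_prod -big_split; apply: eq_bigr => i _.
rewrite rmorphM !rmorphXn fE.
exact: (@clear_denominator K (tf (P i)) (tf Q) _ _ (ltnW (ltn_ord (e i))) tQ0).
Qed.

End CountingRatfun.

(** * Fixed fields of automorphisms with an infinite orbit *)

Local Notation horner_ringE := (hornerD, hornerN, hornerM, hornerZ, hornerXn).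

Section FixedFields.
Variables (k K : fieldType) (iota : {rmorphism k -> K}).
Implicit Types (S : K -> Prop) (f : K) (P Q : {poly K}).

Lemma gen_field0 S : gen_field iota S 0.
Proof. by rewrite -(rmorph0 iota); exact: gen_const. Qed.

Lemma gen_field1 S : gen_field iota S 1.
Proof. by rewrite -(rmorph1 iota); exact: gen_const. Qed.

Lemma gen_field_sub S f g :
  gen_field iota S f -> gen_field iota S g -> gen_field iota S (f - g).
Proof. by move=> Sf Sg; apply: gen_add => //; exact: gen_opp. Qed.

Lemma gen_field_exp S f n : gen_field iota S f -> gen_field iota S (f ^+ n).
Proof.
move=> Sf; elim: n => [|n IH]; first exact: gen_field1.
by rewrite exprS; exact: gen_mul.
Qed.

Lemma gen_field_prod S I (r : seq I) (p : pred I) (F : I -> K) :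
  (forall i, p i -> gen_field iota S (F i)) ->
  gen_field iota S (\prod_(i <- r | p i) F i).
Proof.
by move=> SF; apply: big_ind => //; [exact: gen_field1|exact: gen_mul].
Qed.

Definition polyOver_gen S P := forall i, gen_field iota S P`_i.

Lemma polyOver_genC S c : gen_field iota S c -> polyOver_gen S c%:P.
Proof.
by move=> Sc i; rewrite coefC; case: eqP => // _; exact: gen_field0.
Qed.

Lemma polyOver_genX S : polyOver_gen S 'X.
Proof.
by move=> i; rewrite coefX; case: eqP => _; [exact: gen_field1|exact: gen_field0].
Qed.

Lemma polyOver_genD S P Q :
  polyOver_gen S P -> polyOver_gen S Q -> polyOver_gen S (P + Q).
Proof. by move=> SP SQ i; rewrite coefD; exact: gen_add. Qed.

Lemma polyOver_genN S P : polyOver_gen S P -> polyOver_gen S (- P).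
Proof. by move=> SP i; rewrite coefN; exact: gen_opp. Qed.

Lemma polyOver_genM S P Q :
  polyOver_gen S P -> polyOver_gen S Q -> polyOver_gen S (P * Q).
Proof.
move=> SP SQ i; rewrite coefM; apply: big_ind => [||j _].
- exact: gen_field0.
- by move=> *; exact: gen_add.
- exact: gen_mul.
Qed.

Lemma polyOver_genXn S P n : polyOver_gen S P -> polyOver_gen S (P ^+ n).
Proof.
move=> SP; elim: n => [|n IH]; last by rewrite exprS; exact: polyOver_genM.
by apply: polyOver_genC; exact: gen_field1.
Qed.

Section Orbit.
Variables (gamma : {rmorphism K -> K}) (x : K).
Hypothesis x_orbit : injective (fun j => iter j gamma x).

(** The orbit of a root consists of roots, so there are infinitely many. *)
Lemma orbit_poly_eq0 P :
  (forall i, gamma P`_i = P`_i) -> P.[x] = 0 -> P = 0.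
Proof.
move=> gP Px; apply: contraTeq isT => P0.
have gPx j : P.[iter j gamma x] = 0.
  elim: j => //= j /(congr1 gamma); rewrite rmorph0 -horner_map /= => gPj.
  by rewrite -[RHS]gPj; congr horner; apply/polyP => i; rewrite coef_map /= gP.
have := max_poly_roots (rs := [seq iter j gamma x | j <- seq.iota 0 (size P)]) P0.
rewrite size_map size_iota ltnn; apply.
  by apply/allP => _ /mapP[j _ ->]; rewrite rootE gPx.
by rewrite map_inj_uniq ?iota_uniq.
Qed.

End Orbit.

Section Quadratic.
Variables (S : K -> Prop) (x y : K) (c0 c1 c2 : {poly K}).
Hypotheses (Sc0 : polyOver_gen S c0) (Sc1 : polyOver_gen S c1)
  (Sc2 : polyOver_gen S c2).
Hypothesis c2x_neq0 : c2.[x] != 0.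
Hypothesis quad_xy : c2.[x] * y ^+ 2 + c1.[x] * y + c0.[x] = 0.
Local Notation over := (polyOver_gen S).

(** Numerator and denominator are linear in [y].  The denominator is not
    required to be free of [y], which makes stability under inversion immediate
    and spares the proof that the norm of a nonzero element is nonzero. *)
Definition lin_frac f := exists P Q U V : {poly K},
  [/\ [/\ over P, over Q, over U & over V], U.[x] + V.[x] * y != 0 &
      f = (P.[x] + Q.[x] * y) / (U.[x] + V.[x] * y)].

Lemma mul_lin (P Q P' Q' : {poly K}) :
  c2.[x] * ((P.[x] + Q.[x] * y) * (P'.[x] + Q'.[x] * y)) =
  (c2 * P * P' - c0 * Q * Q').[x]
    + (c2 * (P * Q' + Q * P') - c1 * Q * Q').[x] * y.
Proof.
rewrite !horner_ringE.
have -> : c0.[x] = - (c2.[x] * y ^+ 2 + c1.[x] * y).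
  by apply/eqP; rewrite -addr_eq0 addrC quad_xy.
ring.
Qed.

Lemma over_mul_lin P Q P' Q' : over P -> over Q -> over P' -> over Q' ->
  over (c2 * P * P' - c0 * Q * Q') /\
  over (c2 * (P * Q' + Q * P') - c1 * Q * Q').
Proof.
by move=> *; split; apply: polyOver_genD; try apply: polyOver_genN;
  do ?apply: polyOver_genM => //; apply: polyOver_genD; exact: polyOver_genM.
Qed.

Lemma lin_fracM f g : lin_frac f -> lin_frac g -> lin_frac (f * g).
Proof.
move=> [P [Q [U [V [[SP SQ SU SV] D0 ->]]]]].
move=> [P' [Q' [U' [V' [[SP' SQ' SU' SV'] D0' ->]]]]].
have [SN1 SN2] := over_mul_lin SP SQ SP' SQ'.
have [SD1 SD2] := over_mul_lin SU SV SU' SV'.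
do 4!eexists; split; [by split; [exact: SN1|exact: SN2|exact: SD1|exact: SD2]|..].
  by rewrite -mul_lin !mulf_neq0.
by rewrite -!mul_lin mulf_div -[RHS]mulf_div divff // mul1r.
Qed.

Lemma lin_fracD1 f : lin_frac f -> lin_frac (f + 1).
Proof.
move=> [P [Q [U [V [[SP SQ SU SV] D0 ->]]]]].
exists (P + U), (Q + V), U, V; split => //.
  by split=> //; exact: polyOver_genD.
apply: (mulIf D0); rewrite mulrDl mul1r !divfK // !horner_ringE; ring.
Qed.

Lemma lin_fracN f : lin_frac f -> lin_frac (- f).
Proof.
move=> [P [Q [U [V [[SP SQ SU SV] D0 ->]]]]].
exists (- P), (- Q), U, V; split => //.
  by split=> //; exact: polyOver_genN.
by rewrite !horner_ringE -mulNr; congr (_ / _); ring.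
Qed.

Lemma lin_frac_const c : gen_field iota S c -> lin_frac c.
Proof.
move=> Sc; exists c%:P, 0, 1, 0; rewrite !hornerE oner_neq0 divr1; split=> //.
by split; apply: polyOver_genC => //; [exact: gen_field0|exact: gen_field1
  |exact: gen_field0].
Qed.

Lemma lin_fracV f : lin_frac f -> lin_frac f^-1.
Proof.
have [->|f0] := eqVneq f 0; first by rewrite invr0.
move=> [P [Q [U [V [[SP SQ SU SV] D0 fE]]]]].
exists U, V, P, Q; split=> //; last by rewrite fE invf_div.
by apply: contraNneq f0 => P0; rewrite fE P0 mul0r.
Qed.

(** As [f + g = (f / g + 1) * g], sums reduce to products and to adding 1. *)
Lemma lin_fracD f g : lin_frac f -> lin_frac g -> lin_frac (f + g).
Proof.
have [->|g0] := eqVneq g 0; first by rewrite addr0.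
move=> lf lg; have -> : f + g = (f * g^-1 + 1) * g by rewrite mulrDl mul1r divfK.
by apply: lin_fracM => //; apply: lin_fracD1; apply: lin_fracM => //; exact: lin_fracV.
Qed.

Lemma gen_field_lin_frac f :
  gen_field iota (fun z => S z \/ z = x \/ z = y) f -> lin_frac f.
Proof.
elim=> [c|{}f|{}f g _ + _|{}f _|{}f g _ + _|{}f _].
- by apply: lin_frac_const; exact: gen_const.
- have S0 := polyOver_genC (gen_field0 S); have S1 := polyOver_genC (gen_field1 S).
  case=> [Sf|[->|->]]; first by apply: lin_frac_const; exact: gen_mem.
  + by exists 'X, 0, 1, 0; rewrite !hornerE oner_neq0 divr1; split=> //; split=> //;
      exact: polyOver_genX.
  + by exists 0, 1, 1, 0; rewrite !hornerE oner_neq0 divr1; split.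
- exact: lin_fracD.
- exact: lin_fracN.
- exact: lin_fracM.
- exact: lin_fracV.
Qed.

Variable gamma : {rmorphism K -> K}.
Hypothesis gamma_S : forall f, gen_field iota S f -> gamma f = f.
Hypothesis x_orbit : injective (fun j => iter j gamma x).
Hypothesis disc_nonsquare : forall A B : {poly K},
  A ^+ 2 = B ^+ 2 * (c1 ^+ 2 - 4%:R * c0 * c2) -> B = 0.
Hypothesis generated : forall f,
  gen_field iota (fun z => S z \/ z = x \/ z = y) f.

(** Writing [f] as a quotient of linear expressions in [y], the polynomials [A]
    and [B] below satisfy [A.[x] + B.[x] * y = 0].  The norm of this element has
    invariant coefficients and vanishes on the orbit of [x], so it is the zero
    polynomial; then the discriminant times [B ^+ 2] is a square, and
    [A = B = 0]. *)
Theorem fixed_gen_field f : gamma f = f -> gen_field iota S f.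
Proof.
move=> gf; have [P [Q [U [V [[SP SQ SU SV] D0 fE]]]]] :=
  gen_field_lin_frac (generated f).
pose A := P - f *: U; pose B := Q - f *: V.
have gfix (W : {poly K}) i : over W -> gamma W`_i = W`_i by move=> SW; exact: gamma_S.
have AB0 : A.[x] + B.[x] * y = 0.
  apply/eqP; rewrite !horner_ringE; apply/eqP.
  have : f * (U.[x] + V.[x] * y) = P.[x] + Q.[x] * y by rewrite fE divfK.
  by move=> fD; rewrite -[RHS](subrr (P.[x] + Q.[x] * y)) -{2}fD; ring.
have norm0 : c2 * A ^+ 2 - c1 * A * B + c0 * B ^+ 2 = 0.
  apply: (orbit_poly_eq0 x_orbit).
    have gA : map_poly gamma A = A.
      apply/polyP => i; rewrite coef_map /= /A /B coefB coefZ rmorphB rmorphM /=.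
      by rewrite gf !gfix.
    have gB : map_poly gamma B = B.
      apply/polyP => i; rewrite coef_map /= /A /B coefB coefZ rmorphB rmorphM /=.
      by rewrite gf !gfix.
    have gc c : over c -> map_poly gamma c = c.
      by move=> Sc; apply/polyP => i; rewrite coef_map /= gfix.
    move=> i; rewrite -coef_map rmorphD rmorphB !rmorphM /=.
    by rewrite gA gB !gc.
  clearbody A B; rewrite !horner_ringE.
  have -> : A.[x] = - (B.[x] * y) by apply/eqP; rewrite -addr_eq0 AB0.
  transitivity (B.[x] ^+ 2 * (c2.[x] * y ^+ 2 + c1.[x] * y + c0.[x])); first by ring.
  by rewrite quad_xy mulr0.
have B0 : B = 0.
  apply: (@disc_nonsquare (2%:R * c2 * A - c1 * B)); clearbody A B.
  transitivity (4%:R * c2 * (c2 * A ^+ 2 - c1 * A * B + c0 * B ^+ 2)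
     + B ^+ 2 * (c1 ^+ 2 - 4%:R * c0 * c2)); first by ring.
  by rewrite norm0 mulr0 add0r.
have A0 : A = 0.
  apply/eqP; rewrite -sqrf_eq0; move/eqP: norm0.
  rewrite B0 expr0n /= !mulr0 subr0 addr0 mulf_eq0 => /orP[/eqP c20|//].
  by case/eqP: c2x_neq0; rewrite c20 horner0.
(* [W = f *: Z] exhibits [f] as a quotient of two coefficients. *)
have quot (W Z : {poly K}) : over W -> over Z -> W - f *: Z = 0 -> Z != 0 ->
    gen_field iota S f.
  move=> SW SZ /subr0_eq WZ Z0; have -> : f = W`_(size Z).-1 * (lead_coef Z)^-1.
    by rewrite WZ coefZ mulfK // lead_coef_eq0.
  by apply: gen_mul; [exact: SW|apply: gen_inv; exact: SZ].
have [U0|U0] := eqVneq U 0; last exact: (quot P U).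
have [V0|V0] := eqVneq V 0; last exact: (quot Q V).
by rewrite U0 V0 !hornerE eqxx in D0.
Qed.

End Quadratic.

(** A square of degree at most 2 is the square of a linear polynomial, and so
    has discriminant zero. *)
Lemma quadratic_nonsquare (a b c : K) : b ^+ 2 - 4%:R * a * c != 0 ->
  forall A B : {poly K},
    A ^+ 2 = B ^+ 2 * (a *: 'X^2 + b *: 'X + c%:P) -> B = 0.
Proof.
move=> abc A B AB; apply: contraTeq isT => B0.
have /dvdpP[Q AE] : B %| A.
  by rewrite -(@dvdp_pexp2r _ _ _ 2) // AB dvdp_mulIl.
have QE : Q ^+ 2 = a *: 'X^2 + b *: 'X + c%:P.
  apply: (mulfI (expf_neq0 2 B0)); rewrite -AB AE; ring.
have sQ : (size Q <= 2)%N.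
  have : (size (Q ^+ 2) <= 3)%N.
    rewrite QE; apply/leq_sizeP => j j3; rewrite !coefE.
    by case: j j3 => [|[|[|j]]] // _; rewrite !mulr0 !addr0.
  by have := size_exp Q 2; move: (size Q) (size (Q ^+ 2)) => u v; lia.
have {}QE i : (Q ^+ 2)`_i = (a *: 'X^2 + b *: 'X + c%:P)`_i by rewrite QE.
have Q2 : Q`_2 = 0 by exact: nth_default.
move: (QE 0%N) (QE 1%N) (QE 2%N).
rewrite expr2 !coefM !big_ord_recl !big_ord0 /bump /= !coefE /= Q2.
rewrite !(mulr0, mul0r, mulr1, addr0, add0r) => c_E b_E a_E.
by case/eqP: abc; rewrite -a_E -b_E -c_E; ring.
Qed.

End FixedFields.

(** * Transcendence degree *)

Lemma rmorph_mmap (k : nzRingType) (A B : comNzRingType) (h : {rmorphism A -> B})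
    m (f : {rmorphism k -> A}) (v : 'I_m -> A) P :
  h (mmap f v P) = mmap (h \o f) (h \o v) P.
Proof.
rewrite /mmap rmorph_sum; apply: eq_bigr => e _.
rewrite rmorphM /mmap1 rmorph_prod; congr (_ * _).
by apply: eq_bigr => i _; rewrite rmorphXn.
Qed.

Section TranscendenceDegree.
Variables (R : realType) (N : finType).
Local Notation K := (ratfun R N).
Local Notation tf := (@polyfrac R N).

(** The element [x] is transcendental over the fixed field, because a polynomial
    relation would hold on its whole orbit.  Adding it to an independent family
    of fixed elements must therefore respect the bound given by the number of
    variables. *)
Lemma card_fixed_alg_indep (gamma : {rmorphism K -> K}) (x : K) m
    (t : 'I_m -> K) :
  (forall c, gamma (ratC c) = ratC c) ->
  injective (fun j => iter j gamma x) ->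
  (forall i, gamma (t i) = t i) -> alg_indep ratC t -> (m < #|N|)%N.
Proof.
move=> gC x_orbit gt t_indep; rewrite ltnNge; apply/negP => Nm.
pose f (i : 'I_m.+1) := if unlift ord0 i is Some j then t j else x : K.
have [D [c [e0 ce0] rel]] := @monomials_lindep R N _ f Nm.
pose mon (e : {ffun 'I_m.+1 -> 'I_D}) :=
  [multinom (e (lift ord0 i) : nat) | i < m].
pose tm (e : {ffun 'I_m.+1 -> 'I_D}) := \prod_i t i ^+ e (lift ord0 i).
pose P : {poly K} := \sum_e (ratC (c e) * tm e) *: 'X^(e ord0).
have P0 : P = 0.
  apply: (orbit_poly_eq0 x_orbit) => [i|].
    rewrite coef_sum rmorph_sum; apply: eq_bigr => e _.
    rewrite coefZ coefXn !rmorphM rmorph_prod rmorph_nat gC; congr (_ * _ * _).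
    by apply: eq_bigr => j _; rewrite rmorphXn gt.
  rewrite horner_sum -[RHS]rel; apply: eq_bigr => e _.
  rewrite hornerZ hornerXn -mulrA; congr (_ * _).
  rewrite big_ord_recl /f unlift_none mulrC; congr (_ * _).
  by apply: eq_bigr => i _; rewrite liftK.
pose L : {mpoly R[m]} :=
  \sum_(e : {ffun 'I_m.+1 -> 'I_D} | e ord0 == e0 ord0) c e *: 'X_[mon e].
have L0 : L = 0.
  apply: t_indep; rewrite rmorph_sum.
  transitivity P`_(e0 ord0); last by rewrite P0 coef0.
  rewrite coef_sum [LHS]big_mkcond; apply: eq_bigr => e _ /=.
  rewrite coefZ coefXn eq_sym val_eqE; case: eqP => _; last by rewrite mulr0.
  rewrite mulr1 mmapZ mmapX; congr (_ * _).
  by apply: eq_bigr => i _; rewrite mnmE.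
case/eqP: ce0; have := congr1 (mcoeff (mon e0)) L0.
rewrite mcoeff0 raddf_sum (bigD1 e0) //= big1 => [|e /andP[/eqP e00 ee0]].
  by rewrite addr0 mcoeffZ mcoeffX eqxx mulr1.
rewrite mcoeffZ mcoeffX; case: eqP => [/mnmP mon_e|_]; last by rewrite mulr0.
case/eqP: ee0; apply/ffunP => i; case: (unliftP ord0 i) => [j ->|-> //].
by apply/val_inj; have := mon_e j; rewrite !mnmE.
Qed.

Lemma alg_indep_var m (u : 'I_m -> N) : injective u ->
  alg_indep ratC (fun i => var (u i) : K).
Proof.
move=> u_inj P.
pose up := mmap (@mpolyC #|N| R) (fun i => 'X_(enum_rank (u i))).
pose back := mmap (@mpolyC m R) (fun j : 'I_#|N| =>
  if [pick i | u i == enum_val j] is Some i then 'X_i else 0).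
have -> : mmap ratC (fun i => var (u i)) P = tf (up P).
  by rewrite /up rmorph_mmap.
have upK : back (up P) = P.
  rewrite -[RHS]comp_mpoly_id /comp_mpoly /up /back rmorph_mmap.
  apply: eq_bigr => e _; rewrite /= mmapC; congr (_ * _).
  apply: eq_bigr => i _; rewrite /= mmapX mmap1U tnth_mktuple enum_rankK.
  by case: pickP => [j /eqP/u_inj -> //|/(_ i)]; rewrite eqxx.
by move/eqP; rewrite polyfrac_eq0 => /eqP P0; rewrite -upK P0 /back mmap0.
Qed.

Lemma local_eval_sum (s : {rmorphism {mpoly R[#|N|]} -> K}) (I : Type)
    (r : seq I) (f y : I -> K) :
  (forall i, local_eval tf s (f i) (y i)) ->
  local_eval tf s (\sum_(i <- r) f i) (\sum_(i <- r) y i).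
Proof.
move=> fy; apply: (big_ind2 (local_eval tf s)) => //.
- by rewrite -{1}(rmorph0 tf) -(rmorph0 s); exact: local_eval_id.
- by move=> *; exact: local_evalD.
Qed.

Lemma local_eval_prod (s : {rmorphism {mpoly R[#|N|]} -> K}) (I : Type)
    (r : seq I) (p : pred I) (f y : I -> K) :
  (forall i, p i -> local_eval tf s (f i) (y i)) ->
  local_eval tf s (\prod_(i <- r | p i) f i) (\prod_(i <- r | p i) y i).
Proof.
move=> fy; apply: (big_ind2 (local_eval tf s)) => //.
- exact: local_eval1.
- by move=> *; exact: local_evalM.
Qed.

(** In a polynomial relation, divide by the highest power of [t i0] and
    specialise: [1 / t i0] becomes 0, so only the terms of highest degree in
    [t i0] survive, and they give a relation among the [v i] with [i != i0]. *)
Lemma alg_indep_pole (s : {rmorphism {mpoly R[#|N|]} -> K}) m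
    (t v : 'I_m -> K) i0 :
  (forall c, s c%:MP = ratC c) ->
  t i0 != 0 -> local_eval tf s (t i0)^-1 0 ->
  (forall i, i != i0 -> local_eval tf s (t i) (v i)) ->
  alg_indep ratC v -> alg_indep ratC t.
Proof.
move=> sC t0 ht0 ht v_indep P Pt; apply: contraTeq isT => P0.
pose d := (\max_(e <- msupp P) e i0)%N.
have eld e : e \in msupp P -> (e i0 <= d)%N.
  by move=> eP; rewrite /d (bigD1_seq e) //= leq_maxl.
have lead_rel : local_eval tf s
    (\sum_(e <- msupp P) ratC P@_e * (\prod_(i | i != i0) t i ^+ e i)
                           * (t i0)^-1 ^+ (d - e i0))
    (\sum_(e <- msupp P) ratC P@_e * (\prod_(i | i != i0) v i ^+ e i)
                           * 0 ^+ (d - e i0)).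
  apply: local_eval_sum => e; apply: local_evalM; last exact: local_evalX.
  apply: local_evalM; last by apply: local_eval_prod => i /ht; exact: local_evalX.
  by rewrite -[X in local_eval _ _ _ X]sC; exact: local_eval_id.
have lhs0 : \sum_(e <- msupp P) ratC P@_e * (\prod_(i | i != i0) t i ^+ e i)
                           * (t i0)^-1 ^+ (d - e i0) = 0.
  apply: (mulIf (expf_neq0 d t0)); rewrite mul0r mulr_suml -[RHS]Pt.
  rewrite /mmap big_seq [RHS]big_seq; apply: eq_bigr => e /eld ed.
  rewrite -!mulrA; congr (_ * _); rewrite /mmap1 [in RHS](bigD1 i0) //= mulrC.
  by rewrite -{2}(subnKC ed) exprD mulrCA mulrA -mulrA -exprMn mulVf // expr1n mulr1.
rewrite lhs0 in lead_rel.
pose L := \sum_(e <- msupp P | e i0 == d) P@_e *: 'X_[e].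
have L0 : L = 0.
  apply: v_indep; have := local_eval0 _ lead_rel.
  move=> /(_ _)/(congr1 (fun z => z * v i0 ^+ d)); rewrite mul0r => <-; last first.
    by move=> S /eqP; rewrite polyfrac_eq0 => /eqP ->; rewrite rmorph0.
  rewrite rmorph_sum mulr_suml big_mkcond big_seq [RHS]big_seq.
  apply: eq_bigr => e /eld ed; rewrite expr0n subn_eq0.
  have [<-|ne] := eqVneq (e i0) d.
    rewrite leqnn mulr1 /= mmapZ mmapX -mulrA; congr (_ * _).
    by rewrite /mmap1 [in LHS](bigD1 i0) //= mulrC.
  by rewrite leqNgt ltn_neqAle ne ed /= mulr0 mul0r.
(* The maximal degree [d] is attained, so [L] has a nonzero coefficient. *)
have [e eP ed] : exists2 e, e \in msupp P & e i0 = d.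
  have : msupp P != [::] by rewrite msupp_eq0.
  rewrite /d; elim: (msupp P) => // e r IH _; rewrite big_cons.
  have [->|r0] := eqVneq r [::].
    by exists e; rewrite ?mem_head // big_nil maxn0.
  have [e' e'r e'd] := IH r0.
  have [le|le] := leqP (e i0) (\max_(j <- r) j i0)%N.
    by exists e'; rewrite ?inE ?e'r ?orbT // e'd; apply/esym/maxn_idPr.
  by exists e; rewrite ?mem_head //; apply/esym/maxn_idPl/ltnW.
move: (eP); rewrite -[_ \in _]negbK -mcoeff_eq0 => /eqP[]; have := congr1 (mcoeff e) L0.
rewrite mcoeff0 raddf_sum big_mkcond (bigD1_seq e) //= ed eqxx.
rewrite mcoeffZ mcoeffX eqxx mulr1 big1 ?addr0 // => e' ee'.
by case: ifP; rewrite ?mcoeff0 // mcoeffZ mcoeffX (negPf ee') mulr0.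
Qed.

End TranscendenceDegree.

(** * Substitutions and the common recurrence *)

Lemma subf_div (F : fieldType) (a b c d : F) : b != 0 -> d != 0 ->
  a / b - c / d = (a * d - c * b) / (b * d).
Proof. by move=> b0 d0; rewrite -mulNr addf_div // mulNr. Qed.

Section Substitution.
Variables (R : realType) (N : finType).
Local Notation K := (ratfun R N).
Local Notation tf := (@polyfrac R N).

Lemma gen_field_vars (S : K -> Prop) :
  (forall v, gen_field ratC S (var v)) -> forall f, gen_field ratC S f.
Proof.
move=> Sv f; rewrite (ratfunE f).
suff SP P : gen_field ratC S (tf P).
  by apply: gen_mul; last apply: gen_inv.
rewrite -psubst_var psubstE /mmap.
apply: big_ind => [||e _]; [exact: gen_field0|by move=> *; exact: gen_add|].
apply: gen_mul; first exact: gen_const.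
by apply: gen_field_prod => i _; apply: gen_field_exp; exact: Sv.
Qed.

Section Morphism.
Variable g : N -> K.
Hypothesis g_inj : injective (psubst g).

(** The proof of injectivity is an argument so that the morphism structure,
    which depends on it, can be inferred. *)
Definition subst_morph : K -> K := let _ := g_inj in subst g.

Let substE P Q : Q != 0 -> subst_morph (tf P / tf Q) = psubst g P / psubst g Q.
Proof. exact: subst_frac. Qed.

Let psubst_neq0 Q : Q != 0 -> psubst g Q != 0.
Proof. by apply: contra_neq => Q0; apply: g_inj; rewrite Q0 rmorph0. Qed.

Let frac (f : K) : exists P Q, [/\ Q != 0, f = tf P / tf Q &
  subst_morph f = psubst g P / psubst g Q].
Proof.
have Q0 : \d_(repr f) != 0 := denom_ratioP _.
exists \n_(repr f), \d_(repr f); split=> //; first exact: ratfunE.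
Qed.

Lemma subst_polyfrac P : subst_morph (tf P) = psubst g P.
Proof.
have := substE P (oner_neq0 _); rewrite [tf 1]rmorph1 [psubst g 1]rmorph1.
by rewrite !divr1.
Qed.

Fact subst_is_zmod_morphism : zmod_morphism subst_morph.
Proof.
move=> f f'; have [P [Q [Q0 fE ->]]] := frac f.
have [P' [Q' [Q0' fE' ->]]] := frac f'.
have -> : f - f' = tf (P * Q' - P' * Q) / tf (Q * Q').
  by rewrite fE fE' subf_div ?polyfrac_eq0 // rmorphB !rmorphM.
rewrite [LHS](substE (P * Q' - P' * Q) (mulf_neq0 Q0 Q0')).
by rewrite (subf_div _ _ (psubst_neq0 Q0) (psubst_neq0 Q0')) rmorphB !rmorphM.
Qed.

Fact subst_is_monoid_morphism : monoid_morphism subst_morph.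
Proof.
split=> [|f f'].
  by rewrite -[X in subst_morph X](rmorph1 tf) subst_polyfrac rmorph1.
have [P [Q [Q0 fE ->]]] := frac f; have [P' [Q' [Q0' fE' ->]]] := frac f'.
have -> : f * f' = tf (P * P') / tf (Q * Q').
  by rewrite fE fE' mulf_div !rmorphM.
rewrite [LHS](substE (P * P') (mulf_neq0 Q0 Q0')).
by rewrite [RHS]mulf_div !rmorphM.
Qed.

HB.instance Definition _ :=
  GRing.isZmodMorphism.Build K K subst_morph subst_is_zmod_morphism.
HB.instance Definition _ :=
  GRing.isMonoidMorphism.Build K K subst_morph subst_is_monoid_morphism.

Lemma subst_morph_var v : subst_morph (var v) = g v.
Proof. by rewrite subst_polyfrac psubstX. Qed.

Lemma subst_morphC c : subst_morph (ratC c) = ratC c.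
Proof. by rewrite [LHS]subst_polyfrac psubstC. Qed.

End Morphism.

Lemma gen_field_fixed (gamma : {rmorphism K -> K}) (S : K -> Prop) :
  (forall c, gamma (ratC c) = ratC c) -> (forall f, S f -> gamma f = f) ->
  forall f, gen_field ratC S f -> gamma f = f.
Proof.
move=> gC gS f; elim=> [c|{}f /gS|{}f g _ fE _ gE|{}f _ fE|{}f g _ fE _ gE|{}f _ fE].
- exact: gC.
- by [].
- by rewrite rmorphD fE gE.
- by rewrite rmorphN fE.
- by rewrite rmorphM fE gE.
- by rewrite fmorphV fE.
Qed.

End Substitution.

Lemma fixed_by_gen_group (T : Type) (g : T -> T) x :
  fixed_by (gen_group g) x <-> g x = x.
Proof.
split=> [|gx h]; first by apply; exact: gen_group_gen.
elim=> {h} //= [f h _ fx _ hx|f h _ fx fK _]; first by rewrite hx.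
by rewrite -{1}fx fK.
Qed.

Section RecurrenceConic.
Variables (F : fieldType) (T x z c m : F).

(** The invariant [T] makes [z] quadratic over the field of [x], [T], [c] and
    [m]. *)
Lemma recurrence_conic : x != 0 -> z != 0 ->
  T = (x ^+ 2 + z ^+ 2 + c * (x + z) + m) / (x * z) ->
  z ^+ 2 + (c - T * x) * z + (x ^+ 2 + c * x + m) = 0.
Proof. by move=> x0 z0 ->; field; rewrite x0 z0. Qed.

Lemma recurrence_disc :
  (c%:P - T *: 'X) ^+ 2 - 4%:R * ('X^2 + c *: 'X + m%:P) * 1%:P =
  (T ^+ 2 - 4%:R) *: 'X^2 + (- (2%:R * c * T) - 4%:R * c) *: 'X
    + (c ^+ 2 - 4%:R * m)%:P.
Proof. by rewrite -!mul_polyC; ring. Qed.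

Lemma recurrence_disc_disc :
  (- (2%:R * c * T) - 4%:R * c) ^+ 2
    - 4%:R * (T ^+ 2 - 4%:R) * (c ^+ 2 - 4%:R * m)
  = 16%:R * ((T + 2%:R) * (c ^+ 2 + m * (T - 2%:R))).
Proof. ring. Qed.

(** Eliminating [m] through the recurrence, [T] becomes [(x' + c + z) / x], where
    [x'] is the image of [x]; this is symmetric in the neighbours [x'] and [z]. *)
Lemma recurrence_invariant (gamma : {rmorphism F -> F}) :
    x != 0 -> z != 0 -> gamma z = x -> gamma x = (x ^+ 2 + c * x + m) / z ->
    gamma c = c -> gamma m = m ->
  gamma ((x ^+ 2 + z ^+ 2 + c * (x + z) + m) / (x * z)) =
    (x ^+ 2 + z ^+ 2 + c * (x + z) + m) / (x * z).
Proof.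
move=> x0 z0 gz gx gc gm; rewrite fmorph_div !rmorphD rmorphM rmorphD !rmorphXn.
rewrite rmorphM gz gc gm.
have xz : x ^+ 2 + c * x + m = gamma x * z by rewrite gx divfK.
have gx0 : gamma x != 0 by rewrite fmorph_eq0.
have -> : m = gamma x * z - x ^+ 2 - c * x by rewrite -xz; ring.
by field; rewrite x0 z0 gx0.
Qed.

End RecurrenceConic.

Section Recurrence.
Variables (R : realType) (N : finType).
Local Notation K := (ratfun R N).
Local Notation tf := (@polyfrac R N).
Let at1 : {rmorphism {mpoly R[#|N|]} -> K} := psubst (fun=> ratC 1).

Variables (gamma : {rmorphism K -> K}) (S : K -> Prop) (x z c m : K).
Variables (c1 m1 : R).
Hypotheses (gammaC : forall a, gamma (ratC a) = ratC a)
  (gammaS : forall f, S f -> gamma f = f).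
Hypotheses (gamma_z : gamma z = x)
  (gamma_x : gamma x = (x ^+ 2 + c * x + m) / z).
Hypotheses (x_at1 : local_eval tf at1 x (ratC 1))
  (z_at1 : local_eval tf at1 z (ratC 1))
  (c_at1 : local_eval tf at1 c (ratC c1)) (m_at1 : local_eval tf at1 m (ratC m1)).
Hypotheses (c1_ge0 : 0 <= c1) (m1_gt0 : 0 < m1).
Let T := (x ^+ 2 + z ^+ 2 + c * (x + z) + m) / (x * z).
Hypotheses (Sc : gen_field ratC S c) (Sm : gen_field ratC S m)
  (ST : gen_field ratC S T).

Let gamma_c : gamma c = c. Proof. exact: gen_field_fixed Sc. Qed.
Let gamma_m : gamma m = m. Proof. exact: gen_field_fixed Sm. Qed.

Lemma local_eval_inj f a b :
  local_eval tf at1 f (ratC a) -> local_eval tf at1 f (ratC b) -> a = b.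
Proof.
move=> fa fb.
have m1E : local_eval tf at1 (ratC (-1)) (ratC (-1)).
  by rewrite -[X in local_eval _ _ _ X](psubstC (fun=> ratC 1)); exact: local_eval_id.
have := local_evalD fa (local_evalM m1E fb).
rewrite rmorphN1 !mulN1r subrr => /local_eval0 ab.
have /eqP : ratC a - ratC b = 0 :> K.
  by apply: ab => P /eqP; rewrite polyfrac_eq0 => /eqP ->; exact: rmorph0.
by rewrite subr_eq0 => /eqP /fmorph_inj.
Qed.

(** The values of the orbits of [x] and [z] at the point where all the variables
    are 1. *)
Let value := fix value j : R * R := if j is j.+1 then
  (((value j).1 ^+ 2 + c1 * (value j).1 + m1) / (value j).2, (value j).1)
  else (1, 1).

(** If [0 < b <= a] then the next value is larger than [a ^+ 2 / b >= a]. *)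
Lemma value_increasing j :
  [/\ 0 < (value j).2, 0 < (value j).1 & (value j).1 < (value j.+1).1].
Proof.
have step (a b : R) : 0 < b -> b <= a -> a < (a ^+ 2 + c1 * a + m1) / b.
  move=> b0 ba; have a0 := ltW (lt_le_trans b0 ba); rewrite ltr_pdivlMr //.
  have := mulr_ge0 c1_ge0 a0; have := ler_wpM2l a0 ba; have := m1_gt0.
  by rewrite expr2; lra.
suff : 0 < (value j).2 <= (value j).1.
  by case/andP=> b0 ba; split=> //; [exact: lt_le_trans ba|exact: step].
elim: j => [|j IH] /=; first by rewrite ltr01 lexx.
case/andP: IH => b0 ba; rewrite (lt_le_trans b0 ba) /=.
exact: ltW (step _ _ b0 ba).
Qed.

Let value_inj : injective (fun j => (value j).1).
Proof.
move=> i j; wlog : i j / (i <= j)%N.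
  by move=> W; case/orP: (leq_total i j) => ij vij; [|apply/esym]; apply: W.
have mono : {homo (fun j => (value j).1) : i j / (i < j)%N >-> i < j}.
  by apply: homo_ltn => [a b d|k]; [exact: lt_trans|case: (value_increasing k)].
by rewrite leq_eqVlt => /predU1P[//|/mono /=]; rewrite lt_neqAle => /andP[/eqP].
Qed.

(** Two equal points of the orbit would have the same value at 1. *)
Lemma recurrence_orbit_inj : injective (fun j => iter j gamma x).
Proof.
have evXZ j : local_eval tf at1 (iter j gamma x) (ratC (value j).1) /\
              local_eval tf at1 (iter j gamma z) (ratC (value j).2).
  elim: j => [//|j [xj zj]]; have -> : iter j.+1 gamma z = iter j gamma x.
    by rewrite iterSr gamma_z.
  have -> : iter j.+1 gamma x =
      ((iter j gamma x) ^+ 2 + c * iter j gamma x + m) / iter j gamma z.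
    elim: (j) => [//|i IH]; rewrite [LHS]iterS [X in gamma X = _]IH.
    by rewrite fmorph_div !rmorphD rmorphXn rmorphM /= gamma_c gamma_m.
  have [b0 _ _] := value_increasing j; split=> //.
  have -> : (value j.+1).1 =
    ((value j).1 ^+ 2 + c1 * (value j).1 + m1) / (value j).2 by [].
  move: (value j).1 (value j).2 b0 xj zj => a b b0 xj zj.
  have Cb0 : ratC b != 0 :> K by rewrite fmorph_eq0 gt_eqF.
  rewrite fmorph_div !rmorphD rmorphXn rmorphM; apply: local_evalM.
    apply: local_evalD => //; apply: local_evalD; first exact: local_evalX.
    exact: local_evalM.
  exact: (local_evalV Cb0 (local_eval_neq0 zj Cb0) zj).
move=> i j /= ij; apply: value_inj; apply: (@local_eval_inj (iter i gamma x)).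
  by case: (evXZ i).
by rewrite ij; case: (evXZ j).
Qed.

Let one0 : ratC 1 != 0 :> K. Proof. by rewrite fmorph_eq0 oner_eq0. Qed.
Let x0 : x != 0. Proof. exact: local_eval_neq0 x_at1 one0. Qed.
Let z0 : z != 0. Proof. exact: local_eval_neq0 z_at1 one0. Qed.

(** At the point where all the variables are 1 each factor is positive. *)
Let disc_neq0 : (T + 2%:R) * (c ^+ 2 + m * (T - 2%:R)) != 0.
Proof.
pose T1 := 1 + 1 + c1 * (1 + 1) + m1.
have at1C a : local_eval tf at1 (ratC a) (ratC a).
  by rewrite -[X in local_eval _ _ _ X](psubstC (fun=> ratC 1)); exact: local_eval_id.
have T_at1 : local_eval tf at1 T (ratC T1).
  rewrite -[T1]divr1 -[1]mulr1 fmorph_div; apply: local_evalM.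
    rewrite /T1 !rmorphD rmorphM rmorphD -{1 2}(expr1n R 2) !rmorphXn.
    by do 3?[apply: local_evalD => //]; [exact: local_evalX|exact: local_evalX|
      apply: local_evalM => //; exact: local_evalD].
  rewrite rmorphM; apply: (local_evalV _ (mulf_neq0 x0 z0)); last exact: local_evalM.
  exact: mulf_neq0 one0 one0.
apply: (@local_eval_neq0 _ _ (fun=> ratC 1) _
  (ratC ((T1 + 2%:R) * (c1 ^+ 2 + m1 * (T1 + - 2%:R))))).
  rewrite rmorphM; apply: local_evalM.
    rewrite rmorphD -(rmorph_nat ratC); exact: local_evalD.
  rewrite rmorphD rmorphXn rmorphM rmorphD -(rmorph_nat ratC) -rmorphN.
  apply: local_evalD; first exact: local_evalX.
  by apply: local_evalM => //; exact: local_evalD.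
rewrite fmorph_eq0 gt_eqF // /T1; apply: mulr_gt0.
  by move: c1_ge0 m1_gt0; lra.
by apply: ltr_wpDl; [exact: sqr_ge0|apply: mulr_gt0 => //; move: c1_ge0 m1_gt0; lra].
Qed.

Theorem recurrence_fixed_field :
  (forall f, gen_field ratC (fun h => S h \/ h = x \/ h = z) f) ->
  forall f, gamma f = f <-> gen_field ratC S f.
Proof.
move=> Kxz f; split; last exact: gen_field_fixed.
pose q0 : {poly K} := 'X^2 + c *: 'X + m%:P.
pose q1 : {poly K} := c%:P - T *: 'X.
have SX := polyOver_genX ratC S.
have SZ a : gen_field ratC S a -> polyOver_gen ratC S (a *: 'X).
  by move=> Sa; rewrite -mul_polyC; apply: polyOver_genM => //; exact: polyOver_genC.
have S1 : polyOver_gen ratC S 1%:P by apply: polyOver_genC; exact: gen_field1.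
have S2 : polyOver_gen ratC S q1.
  apply: polyOver_genD; first exact: polyOver_genC.
  by apply: polyOver_genN; exact: SZ.
have S3 : polyOver_gen ratC S q0.
  apply: polyOver_genD; last exact: polyOver_genC.
  by apply: polyOver_genD; [exact: polyOver_genXn|exact: SZ].
move=> gf; apply: (@fixed_gen_field _ _ _ S x z q0 q1 1%:P S3 S2 S1 _ _ gamma _
  recurrence_orbit_inj _ Kxz f gf).
- by rewrite hornerC oner_neq0.
- have -> : q1.[x] = c - T * x by rewrite hornerD hornerN hornerZ hornerC hornerX.
  have -> : q0.[x] = x ^+ 2 + c * x + m.
    by rewrite !hornerD hornerZ hornerC hornerX hornerXn.
  by rewrite hornerC mul1r (recurrence_conic x0 z0 (erefl T)).
- exact: gen_field_fixed.
- move=> A B; rewrite [q1 ^+ 2 - _]recurrence_disc.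
  apply: quadratic_nonsquare.
  rewrite recurrence_disc_disc; apply: (mulf_neq0 _ disc_neq0).
  by rewrite -(rmorph_nat ratC) fmorph_eq0 pnatr_eq0.
Qed.

End Recurrence.

(** * The A and X spaces *)

Lemma ord_enum_but1 (N : finType) (v0 : N) n : #|N| = n.+1 ->
  exists2 e : 'I_n -> N, injective e &
    forall v, v != v0 <-> exists i, e i = v.
Proof.
move=> cN; have cA : #|[set~ v0]| = n by rewrite cardsC1 cN.
exists (fun i => enum_val (cast_ord (esym cA) i)).
  by move=> i j /enum_val_inj /cast_ord_inj.
move=> v; rewrite -in_set1 -in_setC; split=> [vA|[i <-]]; last exact: enum_valP.
by exists (cast_ord cA (enum_rank_in vA v)); rewrite cast_ordK enum_rankK_in.
Qed.

Section XIdentities.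
Variables (F : fieldType) (x1 x2 : F).
Hypotheses (x10 : x1 != 0) (x20 : x2 != 0).

Lemma G_recurrenceE : (x2 * (x1 + 1) + 1) ^+ 2 / (x1 * x2) =
  (x1 ^+ 2 + x2^-1 ^+ 2 + 2%:R * (x1 + x2^-1) + 1) / (x1 * x2^-1) + 2%:R.
Proof. by field; rewrite x10 x20. Qed.

Lemma X_recurrenceE :
  x2 * (1 + x1) ^+ 2 = (x1 ^+ 2 + 2%:R * x1 + 1) / x2^-1.
Proof. by rewrite invrK; ring. Qed.

(** The factor gained by [y] under the mutation cancels the one gained by
    [x2 * (x1 + 1) + 1]. *)
Lemma arm_invariantE y : 1 + x1 != 0 ->
  y * x1 / (1 + x1) * (x1^-1 * (x2 * (1 + x1) ^+ 2 + 1) + 1) =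
  y * (x2 * (x1 + 1) + 1).
Proof. by move=> x11; field; rewrite x10 x11. Qed.

End XIdentities.

Section Main.
Variables (R : realType) (p q r : nat).
Local Notation node := (node p q r).
Local Notation K := (ratfun R node).
Local Notation tf := (@polyfrac R node).

(** The specialisation [h] gives [t A1] a pole and sends each other [t v] to its
    variable.  Only the nodes other than [A2] carry an invariant: the infinite
    orbit of [x] accounts for one transcendental. *)
Lemma trdeg_invariants (gamma : {rmorphism K -> K}) (Inv : K -> Prop) (x : K)
    (h t : node -> K) n :
  #|{: node}| = n.+1 ->
  (forall c, gamma (ratC c) = ratC c) ->
  injective (fun j => iter j gamma x) ->
  (forall f, Inv f <-> gamma f = f) ->
  (forall v, v != A2 -> gamma (t v) = t v) ->
  t A1 != 0 -> local_eval tf (psubst h) (t A1)^-1 0 ->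
  (forall v, v != A1 -> v != A2 -> local_eval tf (psubst h) (t v) (var v)) ->
  trdeg ratC Inv n.
Proof.
move=> cN gC x_orbit InvE gt t0 pole regular; split; last first.
  move=> m f Inv_f f_indep; rewrite -ltnS -cN.
  by apply: (card_fixed_alg_indep gC x_orbit _ f_indep) => i; apply/InvE.
have [e e_inj eE] := ord_enum_but1 A2 cN.
have eA2 i : e i != A2 by apply/eE; exists i.
exists (t \o e) => [i|]; first by apply/InvE/gt.
have [i0 e0] : exists i, e i = A1 by apply/eE.
apply: (@alg_indep_pole _ _ (psubst h) _ _ (fun i => var (e i)) i0).
- exact: psubstC.
- by rewrite /= e0.
- by rewrite /= e0.
- move=> i ii0; apply: regular => //.
  by apply: contraNneq ii0 => ei; rewrite -(inj_eq e_inj) ei e0.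
- exact: alg_indep_var.
Qed.

(** The specialisation at which [rho_sqrtG] and [G] have a pole. *)
Let h0 (v : node) : K := match v with A1 => 0 | A2 => 0 | _ => var v end.

Let h0E v : v != A1 -> v != A2 -> h0 v = var v. Proof. by case: v. Qed.

Let gA : {rmorphism K -> K} := subst_morph (@psubst_gammaA_inj R p q r).
Let gX : {rmorphism K -> K} := subst_morph (@psubst_gammaX_inj R p q r).

Let gA_var v : gA (var v) = gammaA_img R v. Proof. exact: subst_morph_var. Qed.
Let gX_var v : gX (var v) = gammaX_img R v. Proof. exact: subst_morph_var. Qed.
Let gAC c : gA (ratC c) = ratC c. Proof. exact: subst_morphC. Qed.
Let gXC c : gX (ratC c) = ratC c. Proof. exact: subst_morphC. Qed.

Let A_invariantE f : A_invariant R p q r f <-> gA f = f.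
Proof. exact: fixed_by_gen_group. Qed.
Let X_invariantE f : X_invariant R p q r f <-> gX f = f.
Proof. exact: fixed_by_gen_group. Qed.

Local Notation m := (b2c2d2 R p q r).
Local Notation at1 := (psubst (fun _ : node => ratC 1 : K)).
Local Notation a1 := (var A1 : K).
Local Notation a2 := (var A2 : K).

Let gA_m : gA m = m.
Proof.
rewrite !rmorphM !rmorph_prod; congr (_ * _ * _); apply: eq_bigr => i _;
  by rewrite gA_var gammaA_imgE.
Qed.

Let a10 : a1 != 0 := var_neq0 _ _.
Let a20 : a2 != 0 := var_neq0 _ _.

Lemma rho_sqrtG_recurrence :
  rho_sqrtG R p q r = (a2 ^+ 2 + a1 ^+ 2 + 0 * (a2 + a1) + m) / (a2 * a1).
Proof. by rewrite mul0r addr0 [a2 ^+ 2 + _]addrC [a2 * a1]mulrC. Qed.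

Lemma gammaA_generator f : A_generator R p q r f -> gA f = f.
Proof.
case=> [|i|i|i]; try by rewrite gA_var gammaA_imgE.
rewrite rho_sqrtG_recurrence; apply: (recurrence_invariant a20 a10).
- by rewrite gA_var gammaA_imgE.
- by rewrite gA_var gammaA_imgE mul0r addr0.
- exact: rmorph0.
- exact: gA_m.
Qed.

Lemma b2c2d2_gen : gen_field ratC (A_generator R p q r) m.
Proof.
by do 2?[apply: gen_mul]; apply: gen_field_prod => i _; apply: gen_mem;
  [exact: Agen_b|exact: Agen_c|exact: Agen_d].
Qed.

Let gA_a1 : gA a1 = a2. Proof. by rewrite gA_var gammaA_imgE. Qed.

Let gA_a2 : gA a2 = (a2 ^+ 2 + 0 * a2 + m) / a1.
Proof. by rewrite gA_var gammaA_imgE mul0r addr0. Qed.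

Let var_at1 (v : node) : local_eval tf at1 (var v) (ratC 1).
Proof. exact: (local_eval_var (fun _ => ratC 1)). Qed.

Let ratC_at1 c : local_eval tf at1 (ratC c) (ratC c).
Proof.
by rewrite -[X in local_eval _ _ _ X](psubstC (fun=> ratC 1)); exact: local_eval_id.
Qed.

Let zero_at1 : local_eval tf at1 0 (ratC 0).
Proof. rewrite -[X in local_eval _ _ X _](rmorph0 ratC); exact: ratC_at1. Qed.

Let m_at1 : exists2 y, 0 < y & local_eval tf at1 m (ratC y).
Proof. exact: (@b2c2d2_pos R p q r (fun=> 1) (fun=> ltr01)). Qed.

Let A_orbit : injective (fun j => iter j gA a2).
Proof.
have [y y_gt0 my] := m_at1.
exact: (recurrence_orbit_inj gAC gammaA_generator gA_a1 gA_a2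
  (var_at1 A2) (var_at1 A1) zero_at1 my (lexx 0) y_gt0 (gen_field0 _ _) b2c2d2_gen).
Qed.

Theorem A_invariant_gen f :
  A_invariant R p q r f <-> gen_field ratC (A_generator R p q r) f.
Proof.
rewrite A_invariantE; have [y y_gt0 my] := m_at1; move: f.
apply: (recurrence_fixed_field gAC gammaA_generator gA_a1 gA_a2
  (var_at1 A2) (var_at1 A1) zero_at1 my (lexx 0) y_gt0 (gen_field0 _ _) b2c2d2_gen).
  by rewrite -rho_sqrtG_recurrence; apply: gen_mem; exact: Agen_sqrtG.
apply: gen_field_vars => -[||i|i|i]; apply: gen_mem.
- by right; right.
- by right; left.
- by left; exact: Agen_b.
- by left; exact: Agen_c.
- by left; exact: Agen_d.
Qed.

Let b2c2d2_at0 : local_eval tf (psubst h0) m m.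
Proof.
by do 2?[apply: local_evalM]; apply: local_eval_prod => i _;
  [exact: (local_eval_var h0 (B i))|exact: (local_eval_var h0 (C i))
  |exact: (local_eval_var h0 (D i))].
Qed.

Theorem A_trdeg n : #|{: node}| = n.+1 -> trdeg ratC (A_invariant R p q r) n.
Proof.
move=> cN.
pose num : K := a1 ^+ 2 + a2 ^+ 2 + m.
have num_at0 : local_eval tf (psubst h0) num m.
  have -> : m = (0 : K) ^+ 2 + (0 : K) ^+ 2 + m by rewrite expr0n !add0r.
  apply: local_evalD b2c2d2_at0; apply: local_evalD; apply: local_evalX.
    exact: (local_eval_var h0 A1).
  exact: (local_eval_var h0 A2).
have m0 : m != 0 := b2c2d2_neq0 _ _ _ _.
have num0 : num != 0 := local_eval_neq0 num_at0 m0.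
pose t (v : node) := if v == A1 then rho_sqrtG R p q r else var v.
apply: (@trdeg_invariants gA (A_invariant R p q r) a2 h0 t n cN gAC).
- exact: A_orbit.
- exact: A_invariantE.
- case=> [_|/eqP[]|i _|i _|i _]; first [exact: erefl|apply: gammaA_generator].
  + exact: Agen_sqrtG.
  + exact: Agen_b.
  + exact: Agen_c.
  + exact: Agen_d.
- exact: (mulf_neq0 num0 (invr_neq0 (mulf_neq0 a10 a20))).
- rewrite [t A1]/(num / (a1 * a2)) invf_div.
  have -> : 0 = (0 * 0) / m :> K by rewrite !mul0r.
  apply: local_evalM; last exact: local_evalV m0 num0 num_at0.
  by apply: local_evalM; [exact: (local_eval_var h0 A1)|exact: (local_eval_var h0 A2)].
- by move=> v v1 v2; rewrite /t (negPf v1) -[X in local_eval _ _ _ X](h0E v1 v2);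
    exact: local_eval_var.
Qed.

Local Notation x1 := (var A1 : K).
Local Notation x2 := (var A2 : K).
Local Notation w := (x2 * (x1 + 1) + 1).

Let x1S0 : 1 + x1 != 0.
Proof.
apply: (@local_eval_neq0 _ _ h0 _ (1 + 0)); last by rewrite addr0 oner_neq0.
by apply: local_evalD; [exact: local_eval1|exact: (local_eval_var h0 A1)].
Qed.

Let w_at0 : local_eval tf (psubst h0) w 1.
Proof.
have val1 : 1 = 0 * (0 + 1) + 1 :> K by rewrite mul0r add0r.
rewrite [X in local_eval _ _ _ X]val1.
apply: local_evalD; last exact: local_eval1.
apply: local_evalM; first exact: (local_eval_var h0 A2).
by apply: local_evalD; [exact: (local_eval_var h0 A1)|exact: local_eval1].
Qed.

Let w0 : w != 0. Proof. exact: local_eval_neq0 w_at0 (oner_neq0 _). Qed.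

Let gX_x1 : gX x1 = (x1 ^+ 2 + 2%:R * x1 + 1) / x2^-1.
Proof. by rewrite gX_var gammaX_imgE X_recurrenceE. Qed.

Let gX_z : gX x2^-1 = x1.
Proof. by rewrite fmorphV gX_var gammaX_imgE invrK. Qed.

Let x20V : x2^-1 != 0. Proof. exact: invr_neq0 a20. Qed.

Lemma G_recurrence : G x1 x2 =
  (x1 ^+ 2 + x2^-1 ^+ 2 + 2%:R * (x1 + x2^-1) + 1) / (x1 * x2^-1) + 2%:R.
Proof. exact: G_recurrenceE a10 a20. Qed.

Let gX_w y : y * x1 / (1 + x1) * gX w = y * w.
Proof.
rewrite rmorphD rmorphM rmorphD rmorph1 !gX_var !gammaX_imgE.
by rewrite -(arm_invariantE x2 a10 y x1S0); congr (_ * (_ * (_ + _) + _)).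
Qed.

Lemma gammaX_generator f : X_generator R p q r f -> gX f = f.
Proof.
case=> [|i i0|i i0|i i0|i i0|i i0|i i0].
- rewrite G_recurrence rmorphD rmorph_nat; congr (_ + _).
  apply: (recurrence_invariant a10 x20V gX_z gX_x1); first exact: rmorph_nat.
  exact: rmorph1.
- by rewrite rmorphM gX_var gammaX_imgE i0 gX_w.
- by rewrite rmorphM gX_var gammaX_imgE i0 gX_w.
- by rewrite rmorphM gX_var gammaX_imgE i0 gX_w.
- by rewrite gX_var gammaX_imgE; case: eqP.
- by rewrite gX_var gammaX_imgE; case: eqP.
- by rewrite gX_var gammaX_imgE; case: eqP.
Qed.

Let z_at1 : local_eval tf at1 x2^-1 (ratC 1).
Proof.
have val1 : ratC 1 = (ratC 1)^-1 :> K by rewrite rmorph1 invr1.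
rewrite [X in local_eval _ _ _ X]val1.
apply: (local_evalV _ a20 (var_at1 A2)).
by rewrite rmorph1 oner_neq0.
Qed.

Let two_at1 : local_eval tf at1 2%:R (ratC 2%:R).
Proof. rewrite -[X in local_eval _ _ X _](rmorph_nat ratC); exact: ratC_at1. Qed.

Let one_at1 : local_eval tf at1 1 (ratC 1).
Proof. rewrite -[X in local_eval _ _ X _](rmorph1 ratC); exact: ratC_at1. Qed.

Let two_gen S : gen_field ratC S (2%:R : K).
Proof. by rewrite -(rmorph_nat ratC); exact: gen_const. Qed.

Let X_orbit : injective (fun j => iter j gX x1).
Proof.
exact: (recurrence_orbit_inj gXC gammaX_generator gX_z gX_x1
  (var_at1 A1) z_at1 two_at1 one_at1 (ler0n _ 2) ltr01 (two_gen _) (gen_field1 _ _)).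
Qed.

Theorem X_invariant_gen f :
  X_invariant R p q r f <-> gen_field ratC (X_generator R p q r) f.
Proof.
rewrite X_invariantE; move: f.
apply: (recurrence_fixed_field gXC gammaX_generator gX_z gX_x1
  (var_at1 A1) z_at1 two_at1 one_at1 (ler0n _ 2) ltr01 (two_gen _) (gen_field1 _ _)).
  rewrite -[X in gen_field _ _ X](addrK 2%:R) -G_recurrence.
  by apply: gen_field_sub (two_gen _); apply: gen_mem; exact: Xgen_G.
set S := (fun h => _).
have Sx1 : gen_field ratC S x1 by apply: gen_mem; right; left.
have Sx2 : gen_field ratC S x2.
  by rewrite -[x2]invrK; apply: gen_inv; apply: gen_mem; right; right.
have Sw : gen_field ratC S w.
  apply: gen_add (gen_field1 _ _); apply: gen_mul Sx2 _.
  exact: gen_add Sx1 (gen_field1 _ _).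
have arm y : X_generator R p q r (y * w) -> gen_field ratC S y.
  move=> yw; rewrite -(mulfK w0 y); apply: gen_mul; last exact: gen_inv.
  by apply: gen_mem; left.
apply: gen_field_vars => -[||i|i|i]; first exact: Sx1; first exact: Sx2.
- have [i0|/eqP i0] := eqVneq (i : nat) 0%N; first by apply: arm; exact: Xgen_y2.
  by apply: gen_mem; left; exact: Xgen_y.
- have [i0|/eqP i0] := eqVneq (i : nat) 0%N; first by apply: arm; exact: Xgen_z2.
  by apply: gen_mem; left; exact: Xgen_z.
- have [i0|/eqP i0] := eqVneq (i : nat) 0%N; first by apply: arm; exact: Xgen_w2.
  by apply: gen_mem; left; exact: Xgen_w.
Qed.

Theorem X_trdeg n : #|{: node}| = n.+1 -> trdeg ratC (X_invariant R p q r) n.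
Proof.
move=> cN; pose t (v : node) : K := match v with
  | A1 => G x1 x2 | A2 => 0
  | B i => if i == 0 :> nat then var v * w else var v
  | C i => if i == 0 :> nat then var v * w else var v
  | D i => if i == 0 :> nat then var v * w else var v
  end.
apply: (@trdeg_invariants gX (X_invariant R p q r) x1 h0 t n cN gXC).
- exact: X_orbit.
- exact: X_invariantE.
- case=> [_|/eqP[]|i _|i _|i _]; first [exact: erefl|apply: gammaX_generator];
    first exact: Xgen_G.
  + by rewrite /t; case: eqP => i0; [exact: Xgen_y2|exact: Xgen_y].
  + by rewrite /t; case: eqP => i0; [exact: Xgen_z2|exact: Xgen_z].
  + by rewrite /t; case: eqP => i0; [exact: Xgen_w2|exact: Xgen_w].
- exact: (mulf_neq0 (expf_neq0 2 w0) (invr_neq0 (mulf_neq0 a10 a20))).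
- rewrite [t A1]/(w ^+ 2 / (x1 * x2)) invf_div.
  have -> : 0 = (0 * 0) / 1 ^+ 2 :> K by rewrite !mul0r.
  apply: local_evalM.
    by apply: local_evalM; [exact: (local_eval_var h0 A1)|exact: (local_eval_var h0 A2)].
  exact: (local_evalV (expf_neq0 2 (oner_neq0 _)) (expf_neq0 2 w0)
    (local_evalX 2 w_at0)).
- have arm (b : bool) v : v != A1 -> v != A2 ->
      local_eval tf (psubst h0) (if b then var v * w else var v) (var v).
    move=> v1 v2; have vv : local_eval tf (psubst h0) (var v) (var v).
      by rewrite -[X in local_eval _ _ _ X](h0E v1 v2); exact: local_eval_var.
    case: b; last exact: vv.
    rewrite -[X in local_eval _ _ _ X]mulr1.
    exact: local_evalM vv w_at0.
  by case=> [||i|i|i] v1 v2; [case/eqP: v1|case/eqP: v2|exact: arm|exact: arm|exact: arm].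
Qed.

End Main.

Theorem theorem6p1 (R : realType) (p q r n : nat)
    (hp : (1 <= p)%N) (hq : (1 <= q)%N) (hr : (1 <= r)%N)
    (hpqr : 1 < (p%:R)^-1 + (q%:R)^-1 + (r%:R)^-1 :> rat)
    (hn : n.+1 = (p + q + r - 1)%N) :
  [/\ trdeg (@ratC R (node p q r)) (X_invariant R p q r) n,
      trdeg (@ratC R (node p q r)) (A_invariant R p q r) n,
      (forall f : ratfun R (node p q r),
         X_invariant R p q r f <-> gen_field ratC (X_generator R p q r) f)
    & (forall f : ratfun R (node p q r),
         A_invariant R p q r f <-> gen_field ratC (A_generator R p q r) f)].
Proof.
have cN : #|{: node p q r}| = n.+1 by rewrite card_node // hn.
split; [exact: X_trdeg|exact: A_trdeg|exact: X_invariant_gen|exact: A_invariant_gen].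
Qed.
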